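(* Let $n\ge 2$. A heap of type $\widetilde{C}_n$ is fully commutative if and only if it belongs to one of the five families (ALT), (ZZ), (LP), (RP), (LRP).
   Context: The Coxeter graph $\widetilde{C}_n$ is the path $t,s_1,\dots,s_{n-1},u$ with $m_{ts_1}=m_{s_{n-1}u}=4$ and $m_{s_is_{i+1}}=3$; other pairs of distinct generators commute. An element of the Coxeter group is fully commutative (FC) if any of its reduced expressions can be obtained from any other one using only commutation relations. Heaps. Let $\Gamma$ be a finite graph with vertex set $S$. A $\Gamma$-heap is a finite poset $(H,\le)$ with a labeling $\epsilon:H\to S$ such that (a) for each vertex $s$ and each edge $\{s,s'\}$ the subposets $H_s=\epsilon^{-1}(\{s\})$ and $H_{\{s,s'\}}=\epsilon^{-1}(\{s,s'\})$ are totally ordered; (b) $\le$ is the transitive closure of the relations given by all these chains. Heaps are considered up to label-preserving poset isomorphism. For $I\subseteq S$, $H_I$ is the subposet of elements with labels in $I$; an $s$-element is an element labeled $s$. For a word $\mathbf w=s_{a_1}\cdots s_{a_l}$ in $S$, $\operatorname{Heap}(\mathbf w)$ is the poset on $\{1,\dots,l\}$ with order the transitive closure of $i\prec j$ for $i<j$ and $s_{a_i},s_{a_j}$ equal or adjacent, with labels $i\mapsto s_{a_i}$. A heap is FC if it is $\operatorname{Heap}(\mathbf w)$ for a reduced word $\mathbf w$ of an FC element. A heap $H$ (or subposet $H_I$) is alternating if for each edge $\{s,s'\}$ of the graph (with $s,s'\in I$) the labels of the chain $H_{\{s,s'\}}$ alternate between $s$ and $s'$ from bottom to top. Peaks: $P_{\rightarrow}(s_i)=\operatorname{Heap}(s_is_{i+1}\cdots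 s_{n-1}us_{n-1}\cdots s_{i+1}s_i)$ and $P_{\leftarrow}(s_i)=\operatorname{Heap}(s_is_{i-1}\cdots s_1ts_1\cdots s_{i-1}s_i)$. $H_{\{\leftarrow s_i\}}$ (resp. $H_{\{s_i\rightarrow\}}$) is the restriction of $H$ to the labels $\{t,s_1,\dots,s_i\}$ (resp. $\{s_i,\dots,s_{n-1},u\}$). Families of heaps of type $\widetilde{C}_n$: (ALT): $H$ is alternating. (ZZ): $H=\operatorname{Heap}(\mathbf w)$ where $\mathbf w$ is a finite factor (contiguous subword) of the infinite periodic word $(ts_1s_2\cdots s_{n-1}us_{n-1}\cdots s_2s_1)^\infty$ such that $|H_{s_i}|\ge3$ for at least one $i\in\{1,\dots,n-1\}$. (LP): there is $j\in\{1,\dots,n-1\}$ such that LP(1) $H_{\{\leftarrow s_j\}}=P_{\leftarrow}(s_j)$; LP(2) if $j\ne n-1$ there is no $s_{j+1}$-element between the two $s_j$-elements, and if $j=n-1$ there is no $u$-element between the two $s_{n-1}$-elements; LP(3) $H_{\{s_j\rightarrow\}}$ is alternating when one $s_j$-element is deleted. (RP): there is $k\in\{1,\dots,n-1\}$ such that RP(1) $H_{\{s_k\rightarrow\}}=P_{\rightarrow}(s_k)$; RP(2) if $k\ne1$ there is no $s_{k-1}$-element between the two $s_k$-elements, and if $k=1$ there is no $t$-element between the two $s_1$-elements; RP(3) $H_{\{\leftarrow s_k\}}$ is alternating when one $s_k$-element is deleted. (LRP): there are $1\le j<k\le n-1$ such that LP(1), LP(2), RP(1), RP(2) hold and $H_{\{s_j,\dots,s_k\}}$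 is alternating when both an $s_j$- and an $s_k$-element are deleted. *)

(* Defs.v *)
From Stdlib Require Export Relation_Operators.
From mathcomp Require Export all_boot all_order.

Set Implicit Arguments.
Unset Strict Implicit.
Unset Printing Implicit Defensive.

(* Coxeter groups, by generators and relations.  The group of the Coxeter     *)
(* matrix m (m s s = 1, and m s s' = 0 standing for infinity) is the quotient *)
(* of the words over S by [cox_eq m]; as every generator is an involution,    *)
(* words need no formal inverses.  Group elements are handled through any     *)
(* word representing them.                                                    *)

Inductive cox_step (S : Type) (m : S -> S -> nat) : seq S -> seq S -> Prop :=
  CoxStep u v s s' :
    cox_step m (u ++ flatten (nseq (m s s') [:: s; s']) ++ v) (u ++ v).

Definition cox_eq (S : Type) (m : S -> S -> nat) : seq S -> seq S -> Prop :=
  clos_refl_sym_trans (seq S) (cox_step m).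

Definition reduced (S : Type) (m : S -> S -> nat) (w : seq S) : Prop :=
  forall v, cox_eq m w v -> size w <= size v.

Inductive comm_step (S : Type) (m : S -> S -> nat) : seq S -> seq S -> Prop :=
  CommStep u v s s' :
    m s s' = 2 -> comm_step m (u ++ [:: s; s'] ++ v) (u ++ [:: s'; s] ++ v).

Definition comm_eq (S : Type) (m : S -> S -> nat) : seq S -> seq S -> Prop :=
  clos_refl_sym_trans (seq S) (comm_step m).

(* The element represented by w (w itself need not be reduced) is FC. *)
Definition fully_commutative (S : Type) (m : S -> S -> nat) (w : seq S) : Prop :=
  forall w1 w2, cox_eq m w w1 -> cox_eq m w w2 ->
    reduced m w1 -> reduced m w2 -> comm_eq m w1 w2.

Definition cox_graph (S : eqType) (m : S -> S -> nat) : rel S :=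
  [rel s s' | (s != s') && (m s s' != 2)].

Definition eq_or_adj (S : eqType) (e : rel S) : rel S :=
  [rel s s' | (s == s') || e s s'].

Definition is_heap (S : finType) (e : rel S) (d : Order.disp_t)
    (H : finPOrderType d) (lab : H -> S) : Prop :=
  (forall x y : H, eq_or_adj e (lab x) (lab y) -> (x >=< y)%O)
  /\ (forall x y : H,
        (x <= y)%O =
        connect [rel a b : H | (a <= b)%O && eq_or_adj e (lab a) (lab b)] x y).

(* The order of Heap(w), on the positions (counted from 0) of w. *)
Definition word_le (S : finType) (e : rel S) (w : seq S) : rel 'I_(size w) :=
  connect [rel i j : 'I_(size w) |
    (i < j) && eq_or_adj e (tnth (in_tuple w) i) (tnth (in_tuple w) j)].

(* The subposet A of H is Heap(w), up to label-preserving isomorphism. *)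
Definition iso_Heap (S : finType) (e : rel S) (d : Order.disp_t)
    (H : finPOrderType d) (lab : H -> S) (A : {set H}) (w : seq S) : Prop :=
  exists f : 'I_(size w) -> H,
    [/\ injective f,
        f @: [set: 'I_(size w)] = A,
        forall i, lab (f i) = tnth (in_tuple w) i
      & forall i j, (f i <= f j)%O = word_le e i j].

Definition FC_heap (S : finType) (m : S -> S -> nat) (d : Order.disp_t)
    (H : finPOrderType d) (lab : H -> S) : Prop :=
  exists w : seq S, [/\ reduced m w, fully_commutative m w
                      & iso_Heap (cox_graph m) lab [set: H] w].

Definition restr (S : finType) (d : Order.disp_t) (H : finPOrderType d)
    (lab : H -> S) (I : {set S}) : {set H} := [set x | lab x \in I].

(* [sort] lists the chain from bottom to top (in a heap it is a chain). *)
Definition chain_labels (S : finType) (d : Order.disp_t) (H : finPOrderType d)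
    (lab : H -> S) (A : {set H}) (s s' : S) : seq S :=
  map lab (sort <=%O (enum (A :&: restr lab [set s; s']))).

(* A is a subset of H_I; only the edges inside I are tested. *)
Definition alternating (S : finType) (e : rel S) (d : Order.disp_t)
    (H : finPOrderType d) (lab : H -> S) (I : {set S}) (A : {set H}) : Prop :=
  forall s s' : S, s \in I -> s' \in I -> e s s' ->
    sorted (fun a b => a != b) (chain_labels lab A s s').

(* Type C~_n.  The vertices t, s_1, ..., s_(n-1), u of the path are           *)
(* 0, 1, ..., n-1, n in 'I_n.+1; thus "s_(j+1) if j != n-1, u if j = n-1" is  *)
(* j + 1, and "s_(k-1) if k != 1, t if k = 1" is k - 1.                       *)

Definition mC (n : nat) (i j : 'I_n.+1) : nat :=
  if i == j then 1
  else if (i.+1 == j :> nat) || (j.+1 == i :> nat) then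
    if (minn i j == 0) || (maxn i j == n) then 4 else 3
  else 2.

Definition graphC (n : nat) : rel 'I_n.+1 := cox_graph (@mC n).

Definition word (n : nat) (w : seq nat) : seq 'I_n.+1 := map inord w.

Definition peak_left (n j : nat) : seq 'I_n.+1 :=
  word n (rev (iota 1 j) ++ 0 :: iota 1 j).

Definition peak_right (n k : nat) : seq 'I_n.+1 :=
  word n (iota k (n - k) ++ n :: rev (iota k (n - k))).

Definition zigzag_period (n : nat) : seq 'I_n.+1 :=
  word n (0 :: iota 1 n.-1 ++ n :: rev (iota 1 n.-1)).

Definition labels_from_to (n a b : nat) : {set 'I_n.+1} :=
  [set i : 'I_n.+1 | a <= i <= b].

Definition ALT (n : nat) (d : Order.disp_t) (H : finPOrderType d)
    (lab : H -> 'I_n.+1) : Prop :=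
  alternating (@graphC n) lab [set: 'I_n.+1] [set: H].

(* A finite factor of the infinite periodic word is a factor of some power of *)
(* its period.                                                                *)
Definition ZZ (n : nat) (d : Order.disp_t) (H : finPOrderType d)
    (lab : H -> 'I_n.+1) : Prop :=
  (exists (k : nat) (w : seq 'I_n.+1),
     infix w (flatten (nseq k (zigzag_period n)))
     /\ iso_Heap (@graphC n) lab [set: H] w)
  /\ exists i : 'I_n.+1, 0 < i < n /\ 3 <= #|restr lab [set i]|.

Definition LP1 (n : nat) (d : Order.disp_t) (H : finPOrderType d)
    (lab : H -> 'I_n.+1) (j : 'I_n.+1) : Prop :=
  iso_Heap (@graphC n) lab (restr lab (labels_from_to n 0 j)) (peak_left n j).

Definition LP2 (n : nat) (d : Order.disp_t) (H : finPOrderType d)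
    (lab : H -> 'I_n.+1) (j : 'I_n.+1) : Prop :=
  forall x y z : H, lab x = j -> lab y = j -> lab z = j.+1 :> nat ->
    ~ (x < z < y)%O.

Definition LP3 (n : nat) (d : Order.disp_t) (H : finPOrderType d)
    (lab : H -> 'I_n.+1) (j : 'I_n.+1) : Prop :=
  let I := labels_from_to n j n in
  exists2 x : H, lab x = j & alternating (@graphC n) lab I (restr lab I :\ x).

Definition RP1 (n : nat) (d : Order.disp_t) (H : finPOrderType d)
    (lab : H -> 'I_n.+1) (k : 'I_n.+1) : Prop :=
  iso_Heap (@graphC n) lab (restr lab (labels_from_to n k n)) (peak_right n k).

Definition RP2 (n : nat) (d : Order.disp_t) (H : finPOrderType d)
    (lab : H -> 'I_n.+1) (k : 'I_n.+1) : Prop :=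
  forall x y z : H, lab x = k -> lab y = k -> (lab z).+1 = k :> nat ->
    ~ (x < z < y)%O.

Definition RP3 (n : nat) (d : Order.disp_t) (H : finPOrderType d)
    (lab : H -> 'I_n.+1) (k : 'I_n.+1) : Prop :=
  let I := labels_from_to n 0 k in
  exists2 x : H, lab x = k & alternating (@graphC n) lab I (restr lab I :\ x).

Definition LP (n : nat) (d : Order.disp_t) (H : finPOrderType d)
    (lab : H -> 'I_n.+1) : Prop :=
  exists j : 'I_n.+1, [/\ 0 < j < n, LP1 lab j, LP2 lab j & LP3 lab j].

Definition RP (n : nat) (d : Order.disp_t) (H : finPOrderType d)
    (lab : H -> 'I_n.+1) : Prop :=
  exists k : 'I_n.+1, [/\ 0 < k < n, RP1 lab k, RP2 lab k & RP3 lab k].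

Definition LRP (n : nat) (d : Order.disp_t) (H : finPOrderType d)
    (lab : H -> 'I_n.+1) : Prop :=
  exists j k : 'I_n.+1,
    [/\ [/\ 0 < j, j < k & k < n],
        LP1 lab j /\ LP2 lab j,
        RP1 lab k /\ RP2 lab k
      & let I := labels_from_to n j k in
        exists x y : H,
          [/\ lab x = j, lab y = k
            & alternating (@graphC n) lab I (restr lab I :\ x :\ y)]].

(* Main.v *)
Require Import Defs.
From mathcomp Require Import all_boot all_order.
From mathcomp Require Import zify.
From Stdlib Require Import ClassicalEpsilon FunctionalExtensionality PropExtensionality.

(** Why the theorem holds.  A word is the reading of a linear extension of its
    heap, and the words commutation equivalent to it are the readings of the
    other linear extensions.  Full commutativity is a property of this class:
    [w] is a reduced word of an FC element exactly when no word of its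
    commutation class contains a factor [s s] or a braid [s t s ...] of length
    [m s t >= 3] ([braid_free_FC]).  One direction applies a braid relation and
    sees that it changes the subword of the letters [s] and [t].  The other one
    needs the exchange property, which comes from counting, modulo 2, the
    reflections crossed by a word; together with the exact order of every
    product [s t], obtained from the action of the group by signed
    permutations, it shows that an element with two left descents [s] and [t]
    has a reduced word starting with the full alternating word in [s] and [t]
    ([two_descents]).

    In type affine C, a braid in the class of [w] is a convex chain of the
    heap, and it is visible in [w] itself: it suffices that no letter between
    its elements is close enough to obstruct their commutation
    ([convex_braid_free]).  Suppose that two consecutive [s_i] have no [s_(i+1)]
    between them.  If [i > 1], avoiding a convex [s_i s_(i-1) s_i] requires two
    [s_(i-1)] between them, with no [s_i] in between, and by induction the letters up to
    [i] from the first [s_i] to the second one spell the peak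
    [s_i ... s_1 t s_1 ... s_i] ([between_lpeak]).  Moreover the first letter
    [<= i] after such a peak can only be another [s_i]
    ([first_after_peak]).  If there is one, no [s_(i-1)] lies between it and
    the peak, so that it ends a right peak started by the previous [s_i]: the word
    contains a full turn [s_i ... t ... s_i ... u ... s_i], after which every
    next letter is forced, forwards and backwards, and the whole word is a
    zigzag ([half_turn]).  Otherwise the peak contains all the letters [<= i]
    of the word.  Outside (ZZ), a heap is therefore determined to be in one of
    the other four families by the largest [j] that starts a left peak and the
    smallest [k] that starts a right peak, either of which may be absent: all
    edges between [j] and [k] alternate, but for the repeated [s_j] and [s_k]
    ([convex_braid_free_classification]).

    Conversely, zigzags and words of the form just described are stable under
    commutations, and contain no forbidden factor; so their class is free of
    them ([zigzag_or_peaked_braid_free]).  Nothing is lost in passing from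
    posets to words, as the subposets that occur in the families are chains:
    they appear as subwords of any linear extension. *)

Set Implicit Arguments.
Unset Strict Implicit.
Unset Printing Implicit Defensive.

Import Order.POrderTheory.

(** * Words in a Coxeter group: reflections, exchange, full commutativity *)

(** The alternating word [p q p ...] of length [k]; both sides of a braid
    relation have this form, and the relation [(s t)^m = 1] reads [altw s t (m s
    t).*2 ~~ [::]]. *)
Fixpoint altw (S : Type) (p q : S) (k : nat) : seq S :=
  if k is k'.+1 then p :: altw q p k' else [::].

Section AlternatingWords.
Variable S : Type.
Implicit Types p q : S.

Lemma size_altw p q k : size (altw p q k) = k.
Proof. by elim: k p q => //= k IH p q; rewrite IH. Qed.

Lemma altwD p q k l :
  altw p q (k + l) = altw p q k ++ (if odd k then altw q p l else altw p q l).
Proof. by elim: k p q => //= k IH p q; rewrite IH; case: odd. Qed.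

Lemma altw_rcons p q k :
  altw p q k.+1 = rcons (altw p q k) (if odd k then q else p).
Proof. by rewrite -addn1 altwD -cats1; case: odd. Qed.

Lemma rev_altw p q k :
  rev (altw p q k) = if odd k then altw p q k else altw q p k.
Proof.
elim: k p q => // k IH p q.
rewrite [in LHS]altw_rcons rev_rcons IH /=; by case: odd.
Qed.

Lemma flatten_nseq_altw p q k : flatten (nseq k [:: p; q]) = altw p q k.*2.
Proof. by elim: k => //= k ->. Qed.

End AlternatingWords.

Section CoxeterWords.
Variables (S : eqType) (m : S -> S -> nat).
Implicit Types (s t : S) (u v w x y r : seq S).

Notation "u ~~ v" := (cox_eq m u v) (at level 70).

Lemma coxr w : w ~~ w. Proof. exact: rst_refl. Qed.
Lemma coxs u v : u ~~ v -> v ~~ u. Proof. exact: rst_sym. Qed.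
Lemma coxt u v w : u ~~ v -> v ~~ w -> u ~~ w. Proof. exact: rst_trans. Qed.

Lemma cox_ctx x y u v : u ~~ v -> x ++ u ++ y ~~ x ++ v ++ y.
Proof.
elim=> [_ _ [a b s s'] | u' | u' v' _ | u' v' w' _ IH1 _ IH2].
- rewrite -!catA !(catA x); exact/rst_step/CoxStep.
- exact: coxr.
- exact: coxs.
- exact: coxt IH1 IH2.
Qed.

Lemma cox_cat u u' v v' : u ~~ u' -> v ~~ v' -> u ++ v ~~ u' ++ v'.
Proof.
move=> hu hv; apply: (@coxt _ (u' ++ v)).
  exact: (cox_ctx [::] v).
by have := cox_ctx u' [::] hv; rewrite !cats0.
Qed.

Lemma cox_cons s u v : u ~~ v -> s :: u ~~ s :: v.
Proof. by move=> h; exact: (cox_cat (coxr [:: s]) h). Qed.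

Lemma cox_rel s t : altw s t (m s t).*2 ~~ [::].
Proof.
rewrite -flatten_nseq_altw.
by have := rst_step _ _ _ _ (CoxStep m [::] [::] s t); rewrite cats0.
Qed.

(** A canonical representative of each group element, so that counting and
    membership of group elements make sense in sequences over an [eqType]. *)
Definition nf w : seq S := epsilon (inhabits [::]) (cox_eq m w).

Lemma nfP u v : nf u = nf v <-> u ~~ v.
Proof.
split=> [h | h].
  have hu : u ~~ nf u by apply: epsilon_spec; exists u; exact: coxr.
  have hv : v ~~ nf v by apply: epsilon_spec; exists v; exact: coxr.
  by rewrite h in hu; exact: coxt hu (coxs hv).
rewrite /nf; congr epsilon; apply: functional_extensionality => w.
by apply: propositional_extensionality; split; apply: coxt => //; exact: coxs.
Qed.

Hypothesis m_diag : forall s, m s s = 1.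

Lemma cox_ss s : [:: s; s] ~~ [::].
Proof. by have := cox_rel s s; rewrite m_diag. Qed.

Lemma cox_ss_cat s w : s :: s :: w ~~ w.
Proof. exact: (cox_cat (cox_ss s) (coxr w)). Qed.

Lemma cox_rev_r w : w ++ rev w ~~ [::].
Proof.
elim: w => [|s w IH]; first exact: coxr.
rewrite rev_cons -cats1 /= catA; apply: coxt (cox_ss s).
by apply: cox_cons; exact: (cox_cat IH (coxr [:: s])).
Qed.

Lemma cox_rev_l w : rev w ++ w ~~ [::].
Proof. by have := cox_rev_r (rev w); rewrite revK. Qed.

Lemma cox_rev u v : u ~~ v -> rev u ~~ rev v.
Proof.
move=> h; apply: (@coxt _ (rev u ++ (v ++ rev v))).
  rewrite -{1}(cats0 (rev u)); exact/(cox_cat (coxr _))/coxs/cox_rev_r.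
rewrite catA; apply: (@coxt _ ([::] ++ rev v)); last exact: coxr.
apply: cox_cat (coxr _); apply: (@coxt _ (rev u ++ u)); last exact: cox_rev_l.
exact/(cox_cat (coxr _))/coxs.
Qed.

Lemma cox_braid s t : altw s t (m s t) ~~ altw t s (m s t).
Proof.
set k := m s t.
have hd : altw s t k.*2 = altw s t k ++ drop k (altw s t k.*2).
  by rewrite -addnn altwD drop_size_cat // size_altw.
have hr : rev (drop k (altw s t k.*2)) = altw t s k.
  rewrite rev_drop rev_altw odd_double size_altw -addnn addnK altwD.
  by rewrite take_size_cat // size_altw.
have := cox_rel s t; rewrite -/k hd => h.
rewrite -hr; set d := drop _ _ in h *.
apply: (@coxt _ (altw s t k ++ (d ++ rev d))).
  rewrite -{1}(cats0 (altw s t k)); exact/(cox_cat (coxr _))/coxs/cox_rev_r.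
by rewrite catA; exact: (cox_cat h (coxr _)).
Qed.

Lemma reduced_eq u v : reduced m u -> u ~~ v -> size u = size v -> reduced m v.
Proof. by move=> ru uv suv x /(coxt uv) /ru; rewrite suv. Qed.

Lemma reduced_suffix x w : reduced m (x ++ w) -> reduced m w.
Proof.
move=> r v wv; have := r _ (cox_cat (coxr x) wv).
by rewrite !size_cat leq_add2l.
Qed.

(** A word and its reversal represent inverse elements, as generators are
    involutions. *)
Definition conjw u r := u ++ r ++ rev u.

(** The reflections [(s_1 ... s_(i-1)) s_i (s_1 ... s_(i-1))^-1] attached to the
    letters of [s_1 ... s_k], as unreduced words. *)
Fixpoint reflections w : seq (seq S) :=
  if w is s :: w' then [:: s] :: map (conjw [:: s]) (reflections w') else [::].

Lemma size_reflections w : size (reflections w) = size w.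
Proof. by elim: w => //= s w IH; rewrite size_map IH. Qed.

Lemma conjw_cat u v r : conjw (u ++ v) r = conjw u (conjw v r).
Proof. by rewrite /conjw rev_cat !catA. Qed.

Lemma reflections_cat u v : reflections (u ++ v) = reflections u ++ map (conjw u) (reflections v).
Proof.
elim: u => /= [|s u ->].
  by rewrite -[LHS]map_id; apply: eq_map => r; rewrite /conjw /= cats0.
rewrite map_cat -map_comp; congr (_ :: _ ++ _).
by apply: eq_map => r; rewrite -[s :: u]cat1s conjw_cat.
Qed.

Lemma cox_conj u u' r r' : u ~~ u' -> r ~~ r' -> conjw u r ~~ conjw u' r'.
Proof. by move=> hu hr; do 2![apply: cox_cat => //]; exact: cox_rev. Qed.

Lemma cox_conjK u r : conjw (rev u) (conjw u r) ~~ r.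
Proof.
rewrite -conjw_cat; have h := cox_conj (cox_rev_l u) (coxr r).
by apply: coxt h _; rewrite /conjw /= cats0; exact: coxr.
Qed.

Lemma cox_conj_inj u r r' : conjw u r ~~ conjw u r' -> r ~~ r'.
Proof.
move=> /(cox_conj (coxr (rev u))) h.
exact: coxt (coxs (cox_conjK u r)) (coxt h (cox_conjK u r')).
Qed.

(** The [i]-th reflection of an alternating word is an alternating word of
    length [2i + 1]. So the reflections of [(s t)^m] come twice each, which is
    the heart of the parity argument, and those of a shorter alternating word
    can be compared with the other letter. *)
Lemma reflections_altw s t k :
  reflections (altw s t k) = [seq altw s t i.*2.+1 | i <- iota 0 k].
Proof.
elim: k s t => //= k IH s t; congr (_ :: _).
rewrite IH -map_comp (iotaDl 1 0) -map_comp.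
apply: eq_map => i; rewrite /= /conjw /= add0n cats1 -rcons_cons.
by have := altw_rcons s t i.*2; rewrite /= odd_double => ->.
Qed.

Definition inversions w := map nf (reflections w).

Lemma inversions_cat u v :
  inversions (u ++ v) = inversions u ++ [seq nf (conjw u r) | r <- reflections v].
Proof. by rewrite /inversions reflections_cat map_cat -map_comp. Qed.

(** The reflections [m] steps apart in the relator [(s t)^m] are equal in the
    group, so that a relator contributes an even number of copies of each
    reflection, and it does not move the reflections of the letters that follow.
    *)
Lemma odd_inversions_step w w' (r : seq S) : cox_step m w w' ->
  odd (count_mem r (inversions w)) = odd (count_mem r (inversions w')).
Proof.
case=> u v s t; rewrite flatten_nseq_altw; set k := m s t.
rewrite !inversions_cat !count_cat reflections_cat map_cat count_cat !oddD -map_comp.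
congr (_ (+) _); rewrite reflections_altw -addnn iotaD map_cat map_cat count_cat add0n.
have -> : [seq nf (conjw u r0) | r0 <- [seq altw s t i.*2.+1 | i <- iota k k]]
        = [seq nf (conjw u r0) | r0 <- [seq altw s t i.*2.+1 | i <- iota 0 k]].
  have := iotaDl k 0 k; rewrite addn0 => ->; rewrite -!map_comp; apply: eq_map => i /=.
  apply/nfP/(cox_conj (coxr u)).
  have -> : s :: altw t s (k + i).*2 = altw s t k.*2 ++ altw s t i.*2.+1.
    by rewrite -[LHS]/(altw s t (k + i).*2.+1) doubleD -addnS altwD odd_double.
  exact: (cox_cat (cox_rel s t) (coxr _)).
rewrite oddD addbb addFb; congr (odd (count_mem _ _)).
apply: eq_map => x /=; apply/nfP; rewrite -conjw_cat; apply: cox_conj (coxr _).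
rewrite -[X in _ ~~ X]cats0; apply: cox_cat (coxr _) _.
by rewrite addnn; exact: cox_rel.
Qed.

Lemma odd_inversions w w' r : w ~~ w' ->
  odd (count_mem r (inversions w)) = odd (count_mem r (inversions w')).
Proof. by elim=> {w w'} // [w w' /odd_inversions_step -> | u v w _ -> _ ->]. Qed.

Lemma reflections_delete w r : r \in reflections w ->
  exists2 w', (size w').+1 = size w & r ++ w ~~ w'.
Proof.
elim: w r => //= s w IH r; rewrite inE => /orP[/eqP -> | /mapP[r' /IH[w' sw' h] ->]].
  by exists w => //; exact: cox_ss_cat.
exists (s :: w') => /=; first by rewrite sw'.
apply: cox_cons; rewrite /= -catA /=; apply: coxt h.
exact/(cox_cat (coxr _))/cox_ss_cat.
Qed.

(** If the reflection [s] occurs among those of [w], it can be traded for a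
    letter of [w]. *)
Lemma exchange s w : nf [:: s] \in inversions w ->
  exists2 w', (size w').+1 = size w & w ~~ s :: w'.
Proof.
case/mapP=> r /reflections_delete[w' sw' h] /nfP hs; exists w' => //.
apply: coxt (coxs (cox_ss_cat s w)) _; apply: cox_cons; apply: coxt h.
exact: (cox_cat hs (coxr w)).
Qed.

Lemma uniq_nf_map (g : seq S -> seq S) l :
  (forall r r', nf (g r) = nf (g r') <-> nf r = nf r') ->
  uniq [seq nf (g r) | r <- l] = uniq (map nf l).
Proof.
move=> hg; elim: l => //= r l ->; congr (~~ _ && _).
by apply/mapP/mapP=> -[r' r'in /hg h]; exists r'.
Qed.

Lemma nf_conj u r r' : nf (conjw u r) = nf (conjw u r') <-> nf r = nf r'.
Proof.
rewrite !nfP; split; first exact: cox_conj_inj.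
exact/cox_conj/coxr.
Qed.

(** If a word is reduced its reflections differ, since two equal ones would
    allow the deletion of two letters. If they differ each occurs an odd number
    of times, hence occurs in every word for the same element, which is at least
    as long. *)
Lemma reduced_inversions w : reduced m w <-> uniq (inversions w).
Proof.
split=> [|uw v wv]; last first.
  rewrite -(size_reflections w) -(size_reflections v) -(size_map nf) -(size_map nf (reflections v)).
  apply: uniq_leq_size => // r rw; rewrite -has_pred1 has_count.
  by have := odd_inversions r wv; rewrite count_uniq_mem // rw; case: count.
elim: w => //= s w IH rw; rewrite -map_comp uniq_nf_map; last exact: nf_conj.
rewrite IH ?andbT; last exact: (@reduced_suffix [:: s]).
apply/negP=> /mapP[r rin /nfP /= h].
have {}h : [:: s] ~~ r.
  by apply: (@cox_conj_inj [:: s]); apply: coxt h; exact: (cox_ss_cat s [:: s]).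
have [|w' sw' h'] := @exchange s w; first by apply/mapP; exists r => //; exact/nfP.
have /rw : s :: w ~~ w' by apply: coxt (cox_cons s h') _; exact: cox_ss_cat.
by rewrite /= -sw'; lia.
Qed.

Lemma inversions_head s w : nf [:: s] \in inversions (s :: w).
Proof. exact: mem_head. Qed.

(** With [inversions_head], the way to say that [s] is a left descent: [s] then
    is an inversion of all the words of the element. *)
Lemma inversions_cox w w' r : reduced m w -> w ~~ w' -> r \in inversions w -> r \in inversions w'.
Proof.
move=> /reduced_inversions uw /(odd_inversions r); rewrite count_uniq_mem // => + rin.
by rewrite rin -has_pred1 has_count; case: count.
Qed.

Lemma exchange_cons s w : reduced m w -> ~ reduced m (s :: w) ->
  exists2 w', (size w').+1 = size w & w ~~ s :: w'.
Proof.
move=> /reduced_inversions uw; rewrite reduced_inversions /= -map_comp.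
rewrite uniq_nf_map; last exact: nf_conj.
rewrite -/(inversions w) uw andbT => /negP; rewrite negbK => /mapP[r rin /nfP /= h].
apply: exchange; apply/mapP; exists r => //; apply/nfP.
by apply: (@cox_conj_inj [:: s]); apply: coxt h; exact: (cox_ss_cat s [:: s]).
Qed.

Hypothesis m_sym : forall s t, m s t = m t s.
Hypothesis m_gt1 : forall s t, s != t -> 1 < m s t.
Hypothesis m_order : forall s t k, s != t -> 0 < k < m s t ->
  ~ altw s t k.*2 ~~ [::].

(** The descent [q] is the reflection of some letter. This letter is not in the
    alternating prefix, or else a power of [p q] smaller than [m p q] would be
    trivial; so it can be moved to the front, at the expense of [x] only. *)
Lemma dihedral_step p q x w k : p != q -> k < m p q -> reduced m w ->
  nf [:: q] \in inversions w -> w ~~ altw p q k ++ x -> size w = k + size x ->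
  exists2 y, w ~~ altw q p k.+1 ++ y & size w = k.+1 + size y.
Proof.
move=> pq km rw qw wx sx.
have := inversions_cox rw wx qw; rewrite inversions_cat mem_cat => /orP[|].
  case/mapP=> r; rewrite reflections_altw => /mapP[i]; rewrite mem_iota /= => ik -> /nfP h.
  case: (@m_order q p i.+1); [by rewrite eq_sym | by rewrite m_sym; lia |].
  rewrite doubleS /=; apply: coxt (cox_ss q); apply: cox_cons; exact: coxs.
case/mapP=> r /reflections_delete[y sy ry] /nfP h.
exists y; last by rewrite sx -sy addSnnS.
apply: coxt (coxs (cox_ss_cat q w)) _; apply: cox_cons.
apply: coxt (cox_cons q wx) _.
have {}h := cox_cat h (coxr (altw p q k ++ x)); apply: coxt h _.
rewrite /conjw -!catA; apply: cox_cat (coxr _) _; apply: coxt ry.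
apply: cox_cat (coxr _) _; rewrite catA.
exact: (cox_cat (cox_rev_l _) (coxr _)).
Qed.

(** The alternating prefix is extended one letter at a time, using the two
    descents in turn; when it is full a braid relation lets it start with either
    letter. *)
Lemma two_descents s t w : s != t -> reduced m w ->
  nf [:: s] \in inversions w -> nf [:: t] \in inversions w ->
  exists2 x, w ~~ altw s t (m s t) ++ x & size w = m s t + size x.
Proof.
move=> st rw sw tw.
have [p [q [x [pq wx sx]]]] : exists p q x,
    [/\ (p, q) = (s, t) \/ (p, q) = (t, s), w ~~ altw p q (m s t) ++ x
      & size w = m s t + size x].
  have: m s t <= m s t by []; move: {-2}(m s t) => k.
  elim: k => [|k IH] km; first by exists s, t, w; split; [left | exact: coxr |].
  have [p [q [x [pq wx sx]]]] := IH (ltnW km).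
  have [||||||y wy sy] := @dihedral_step p q x w k => //.
  - by case: pq => -[-> ->]; rewrite // eq_sym.
  - by case: pq => -[-> ->] //; rewrite m_sym.
  - by case: pq => -[_ ->].
  by exists q, p, y; split=> //; case: pq => -[-> ->]; [right | left].
exists x => //; case: pq wx => -[-> ->] // wx; apply: coxt wx _.
by apply: cox_cat (coxr x); rewrite m_sym; exact: cox_braid.
Qed.

Notation "u ~c v" := (comm_eq m u v) (at level 70).

Lemma commr w : w ~c w. Proof. exact: rst_refl. Qed.
Lemma comms u v : u ~c v -> v ~c u. Proof. exact: rst_sym. Qed.
Lemma commt u v w : u ~c v -> v ~c w -> u ~c w. Proof. exact: rst_trans. Qed.

Lemma comm_ctx x y u v : u ~c v -> x ++ u ++ y ~c x ++ v ++ y.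
Proof.
elim=> [_ _ [a b s t st] | u' | u' v' _ | u' v' w' _ IH1 _ IH2].
- rewrite -!catA !(catA x); exact/rst_step/CommStep.
- exact: commr.
- exact: comms.
- exact: commt IH1 IH2.
Qed.

Lemma comm_cons s u v : u ~c v -> s :: u ~c s :: v.
Proof. by move=> h; have := comm_ctx [:: s] [::] h; rewrite !cats0. Qed.

Lemma comm_swap s t w : m s t = 2 -> s :: t :: w ~c t :: s :: w.
Proof. by move=> st; exact/rst_step/(CommStep [::] w). Qed.

Lemma comm_move s y : all (fun t => m s t == 2) y -> s :: y ~c rcons y s.
Proof.
elim: y => [_|t y IH /= /andP[/eqP st /IH h]]; first exact: commr.
exact: commt (comm_swap y st) (comm_cons t h).
Qed.

Lemma comm_cox u v : u ~c v -> u ~~ v.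
Proof.
elim=> [_ _ [a b s t st] | u' | u' v' _ | u' v' w' _ IH1 _ IH2].
- by apply: cox_ctx; have := cox_braid s t; rewrite st.
- exact: coxr.
- exact: coxs.
- exact: coxt IH1 IH2.
Qed.

Lemma comm_size u v : u ~c v -> size u = size v.
Proof.
by elim=> [_ _ [a b s t _] | // | // | u' v' w' _ -> _ ->] //; rewrite !size_cat.
Qed.

(** Two non-commuting letters never cross, so that the subword they form is an
    invariant of the commutation class. It detects braid moves. *)
Lemma comm_filter s t u v : m s t > 2 -> u ~c v ->
  filter (pred2 s t) u = filter (pred2 s t) v.
Proof.
move=> st; elim=> [_ _ [a b s' t' h] | // | // | u' v' w' _ -> _ ->] //.
rewrite !filter_cat; congr (_ ++ (_ ++ _)) => /=.
case ps: ((s' == s) || _) => //=; case pt: ((t' == s) || _) => //=.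
by case/orP: ps h st => /eqP ->; case/orP: pt => /eqP ->;
  rewrite ?m_diag // ?(m_sym t s) => ->.
Qed.

Definition braid_free w := forall v x y s t, w ~c v ->
  (v <> x ++ [:: s; s] ++ y) /\
  (2 < m s t -> v <> x ++ altw s t (m s t) ++ y).

Lemma braid_free_comm w v : w ~c v -> braid_free w -> braid_free v.
Proof. by move=> wv gw v' x y s t vv'; apply: gw; exact: commt vv'. Qed.

Lemma braid_free_cons s w : braid_free (s :: w) -> braid_free w.
Proof.
move=> gw v x y s' t /(comm_cons s) wv.
by have [h1 h2] := gw _ (s :: x) y s' t wv; split=> [|st] e;
  [apply: h1 | apply: (h2 st)]; rewrite e.
Qed.

(** By induction on the length. If [s :: w] were not reduced, then [w] would be
    equal to some reduced [s :: w'], hence commutation equivalent to it, and [s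
    s] would appear. If [t] is another left descent, the full alternating word
    in [s] and [t] can be brought to the front of [s :: w] by commutations; this
    is forbidden unless [s] and [t] commute, in which case [t] can be brought to
    the front. *)
Lemma braid_free_reduced_unique w : braid_free w ->
  reduced m w /\ (forall v, reduced m v -> w ~~ v -> w ~c v).
Proof.
have [N] := ubnP (size w); elim: N w => // N IH [_ _|s w].
  split=> // v rv /coxs /rv; rewrite leqn0 size_eq0 => /eqP ->; exact: commr.
rewrite ltnS => sN gw; have gw' := braid_free_cons gw; have [rw cw] := IH w sN gw'.
have rsw : reduced m (s :: w).
  apply: NNPP => /(exchange_cons rw)[w' sw' ww'].
  have /cw /(_ ww') : reduced m (s :: w') by apply: reduced_eq rw ww' _; rewrite /= sw'.
  by move=> /(comm_cons s) /(gw _ [::] w' s s)[+ _]; apply.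
split=> // v' rv' wv'.
have sv' : size v' = (size w).+1.
  by apply/eqP; rewrite eqn_leq -[_.+1]/(size (s :: w)) rsw ?rv' //; exact: coxs.
case: v' => // t v in rv' wv' sv' *; move: sv' => [sv].
have rv : reduced m v := @reduced_suffix [:: t] v rv'.
have [est | st] := eqVneq s t.
  rewrite -est in wv' *; apply: comm_cons; apply: cw => //.
  apply: coxt (coxs (cox_ss_cat s w)) _; apply: coxt (cox_cons s wv') _.
  exact: cox_ss_cat.
have tw : nf [:: t] \in inversions (s :: w).
  exact: inversions_cox rv' (coxs wv') (inversions_head t v).
have [x wx sx] := two_descents st rsw (inversions_head s w) tw.
have := m_gt1 st; case em: (m s t) => [//|k] k0; rewrite em /= in wx sx.
have wx' : w ~~ altw t s k ++ x.
  apply: coxt (coxs (cox_ss_cat s w)) _; apply: coxt (cox_cons s wx) _.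
  exact: cox_ss_cat.
have wcx : s :: w ~c altw s t (m s t) ++ x.
  rewrite em /=; apply/comm_cons/cw => //; apply: reduced_eq rw wx' _.
  by rewrite size_cat size_altw; lia.
(* The full alternating word is forbidden unless s and t commute. *)
have [k1 | k1] := ltnP 2 (m s t).
  by have [_ /(_ k1)] := gw _ [::] x s t wcx.
have ek : k = 1 by lia.
rewrite em ek /= in wcx; rewrite {}ek in em sx; have wcx' := commt wcx (comm_swap x em).
apply: (commt wcx'); apply: comm_cons.
(* The word s :: x comes after t in the class of s :: w, and is shorter. *)
have [|_ h] := IH (s :: x) _ (braid_free_cons (braid_free_comm wcx' gw)).
  by rewrite /= in sN *; lia.
apply: h => //; apply: coxt (coxs (cox_ss_cat t _)) _.
apply: coxt (cox_cons t (coxt (coxs (comm_cox wcx')) wv')) _.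
exact: cox_ss_cat.
Qed.

(** From right to left, a forbidden factor would contradict minimality, or give
    by a braid move another reduced word whose subword in the letters [s] and
    [t] is different. *)
Theorem braid_free_FC w : braid_free w <-> reduced m w /\ fully_commutative m w.
Proof.
split=> [/braid_free_reduced_unique[rw h] | [rw fw] v x y s t wv].
  split=> // w1 w2 h1 h2 r1 r2; apply: commt (comms (h _ r1 h1)) (h _ r2 h2).
have cwv := comm_cox wv; have rv := reduced_eq rw cwv (comm_size wv).
split=> [ev | st ev].
  have /rv : v ~~ x ++ y.
    by rewrite ev; apply: cox_cat (coxr x) _; exact: cox_ss_cat.
  by rewrite ev !size_cat /=; lia.
have vv' : v ~~ x ++ altw t s (m s t) ++ y by rewrite ev; exact/cox_ctx/cox_braid.
have rv' : reduced m (x ++ altw t s (m s t) ++ y).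
  by apply: reduced_eq rv vv' _; rewrite ev !size_cat !size_altw.
have /(comm_filter st) := fw _ _ cwv (coxt cwv vv') rv rv'.
rewrite ev !filter_cat => /eqP; rewrite eqseq_cat // eqxx /=.
case: (m s t) (st) => //= k; rewrite !eqxx ?orbT => _ /eqP[est].
by move: st; rewrite est m_diag.
Qed.

End CoxeterWords.

(** * The Coxeter matrix of affine type C *)

(** Case analysis on the innermost equality tests first: a test on a conditional
    expression would be opaque to [lia]. *)
Ltac split_nat_eqs :=
  repeat match goal with |- context [?a == ?b] =>
    lazymatch a with context [if _ then _ else _] => fail | _ =>
      case: (@eqP nat a b) => ? /=; try (exfalso; lia) end end; try lia.

Definition flip_at (c : nat) (p : nat * bool) : nat * bool :=
  (p.1, (p.1 == c) (+) p.2).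

Definition swap_at (c : nat) (p : nat * bool) : nat * bool :=
  (if p.1 == c then c.-1 else if p.1 == c.-1 then c else p.1, p.2).

(** The finite quotient of the affine group where [u] acts, like [t], by a
    change of sign: [t] flips the first coordinate, [s_i] exchanges the [i]-th
    and the next one, and [u] flips the last one. A point is a coordinate,
    counted from 0, with a sign. The quotient is small enough to compute with,
    and the order of each [s t] is the same as in the affine group. *)
Definition signed_act (n c : nat) : nat * bool -> nat * bool :=
  if c == 0 then flip_at 0 else if c == n then flip_at n.-1 else swap_at c.

Definition signed_act_word (n : nat) (w : seq 'I_n.+1) (p : nat * bool) :=
  foldr (fun c : 'I_n.+1 => signed_act n c) p w.

Lemma flip_atK c : involutive (flip_at c).
Proof. by case=> x b; rewrite /flip_at /= addbA addbb. Qed.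

Lemma swap_atK c : involutive (swap_at c).
Proof.
case=> x b; rewrite /swap_at /=; congr pair.
by split_nat_eqs.
Qed.

Lemma signed_actK n c : involutive (signed_act n c).
Proof.
rewrite /signed_act; case: ifP => _; first exact: flip_atK.
by case: ifP => _; [exact: flip_atK | exact: swap_atK].
Qed.

Lemma flip_atC c d p : flip_at c (flip_at d p) = flip_at d (flip_at c p).
Proof. by rewrite /flip_at /= addbCA. Qed.

Lemma swap_atC c d p : 0 < c -> c.+1 < d ->
  swap_at c (swap_at d p) = swap_at d (swap_at c p).
Proof.
case: p => x b hc hd; rewrite /swap_at /=; congr pair.
by split_nat_eqs.
Qed.

Lemma flip_swapC c d p : 0 < d -> c != d -> c != d.-1 ->
  flip_at c (swap_at d p) = swap_at d (flip_at c p).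
Proof.
case: p => x b h1 h2 h3; rewrite /swap_at /flip_at /=; congr pair.
by congr addb; split_nat_eqs.
Qed.

Lemma swap_at_braid c p : 0 < c ->
  swap_at c (swap_at c.+1 (swap_at c p)) =
  swap_at c.+1 (swap_at c (swap_at c.+1 p)).
Proof.
case: p => x b hc; rewrite /swap_at /=; congr pair.
by split_nat_eqs.
Qed.

Lemma flip_swap_braid c d p : 0 < d -> (c == d) || (c == d.-1) ->
  flip_at c (swap_at d (flip_at c (swap_at d p))) =
  swap_at d (flip_at c (swap_at d (flip_at c p))).
Proof.
case: p => x b h1 h2; rewrite /swap_at /flip_at /=; congr pair.
  by split_nat_eqs.
Qed.

Section TypeC.
Variables (n : nat) (hn : 1 < n).
Implicit Types (s t : 'I_n.+1).

Lemma mC_diag s : mC s s = 1.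
Proof. by rewrite /mC eqxx. Qed.

Lemma mC_sym s t : mC s t = mC t s.
Proof. by rewrite /mC eq_sym [in LHS]orbC minnC maxnC. Qed.

Lemma mC_gt1 s t : s != t -> 1 < mC s t.
Proof. by rewrite /mC => /negbTE ->; do 2?case: ifP. Qed.

Lemma mC_far s t : (s.+1 < t) || (t.+1 < s) -> mC s t = 2.
Proof.
rewrite /mC -(inj_eq val_inj) /= => h; rewrite ifF; last by lia.
by rewrite ifF //; lia.
Qed.

Variant mC_spec s t : nat -> Prop :=
  | MCeq of s = t : mC_spec s t 1
  | MCfar of (s.+1 < t) || (t.+1 < s) : mC_spec s t 2
  | MCmid of (s.+1 == t) || (t.+1 == s) & 0 < s < n & 0 < t < n : mC_spec s t 3
  | MCend of (s.+1 == t) || (t.+1 == s) & (minn s t == 0) || (maxn s t == n) :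
      mC_spec s t 4.

Lemma mCP s t : mC_spec s t (mC s t).
Proof.
have := ltn_ord s; have := ltn_ord t; rewrite /mC -(inj_eq val_inj) /= => ht hs.
case: eqP => [/val_inj|] st; first exact: MCeq.
case: ifP => adj; last by apply: MCfar; lia.
by case: ifP => e; [apply: MCend | apply: MCmid]; lia.
Qed.

Lemma signed_act_braid s t p :
  signed_act_word (altw s t (mC s t)) p = signed_act_word (altw t s (mC s t)) p.
Proof.
wlog lst : s t / s <= t => [W|].
  by case: (leqP s t) => [/W //|/ltnW/W]; rewrite mC_sym.
have hs := ltn_ord s; have ht := ltn_ord t.
case: mCP => [-> // | far | adj hs' ht' | adj e]; rewrite /signed_act_word /=.
- rewrite /signed_act.
  have -> : (t == 0 :> nat) = false by lia.
  have -> : (s == n :> nat) = false by lia.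
  case: eqP => s0; case: eqP => tn.
  - exact: flip_atC.
  - by apply: flip_swapC; lia.
  - by rewrite flip_swapC //; lia.
  - by apply: swap_atC; lia.
- have et : t = s.+1 :> nat by lia.
  rewrite /signed_act et.
  do ![rewrite ifF; last by lia].
  by rewrite swap_at_braid //; lia.
- rewrite /signed_act.
  have -> : (t == 0 :> nat) = false by lia.
  have -> : (s == n :> nat) = false by lia.
  case: eqP => s0.
    rewrite ifF; last by lia.
    by apply: flip_swap_braid; lia.
  rewrite ifT; last by lia.
  by rewrite flip_swap_braid //; lia.
Qed.

Lemma signed_act_cat u v p :
  @signed_act_word n (u ++ v) p = signed_act_word u (signed_act_word v p).
Proof. exact: foldr_cat. Qed.

Lemma signed_act_rev u p : @signed_act_word n (rev u) (signed_act_word u p) = p.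
Proof.
elim: u p => // s u IH p; rewrite rev_cons -cats1 signed_act_cat /=.
by rewrite signed_actK.
Qed.

(** A relator is an alternating word followed by the inverse of the other side
    of the braid relation. *)
Lemma signed_act_cox u v p : cox_eq (@mC n) u v ->
  signed_act_word u p = signed_act_word v p.
Proof.
move=> h; elim: h p => {u v} // [_ _ [u v s t] | u v w _ IH1 _ IH2] p; last first.
  by rewrite IH1.
rewrite !signed_act_cat flatten_nseq_altw -addnn; congr signed_act_word.
set k := mC s t; have -> : altw s t (k + k) = altw s t k ++ rev (altw t s k).
  by rewrite altwD rev_altw; case: odd.
by rewrite signed_act_cat signed_act_braid -/k -{1}[altw t s k]revK signed_act_rev.
Qed.

Lemma signed_act_inj s t : (forall p, signed_act n s p = signed_act n t p) -> s = t.
Proof.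
wlog lst : s t / s <= t => [W h|].
  by case: (leqP s t) => [/W -> //|/ltnW/W ->].
have hs := ltn_ord s; have ht := ltn_ord t.
move=> h; apply/val_inj/eqP/negPn/negP => /= st.
have := h (t.-1, false).
rewrite /signed_act /flip_at /swap_at /=.
by split_nat_eqs; try case; lia.
Qed.

Lemma cox_gen_inj s t : cox_eq (@mC n) [:: s] [:: t] -> s = t.
Proof. by move=> h; apply: signed_act_inj => p; exact: (signed_act_cox p h). Qed.

Lemma end_order2 s t : mC s t = 4 -> ~ cox_eq (@mC n) [:: s; t; s; t] [::].
Proof.
have hs := ltn_ord s; have ht := ltn_ord t.
case: mCP => // adj e _ h.
have := signed_act_cox (0, false) h; have := signed_act_cox (n.-1, false) h.
rewrite /signed_act_word /signed_act /flip_at /swap_at /=.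
by split_nat_eqs.
Qed.

(** The exponent [k] may be replaced by [mC s t - k]; this leaves [k = 1], where
    two generators would be equal, and [k = 2] with [mC s t = 4]. *)
Lemma mC_order s t k : s != t -> 0 < k < mC s t ->
  ~ cox_eq (@mC n) (altw s t k.*2) [::].
Proof.
move=> st; wlog k2 : k / k <= mC s t - k => [W hk h|].
  case: (leqP k (mC s t - k)) => kk; first exact: W h.
  apply: (W (mC s t - k)); try lia.
  apply: coxt (cox_rel (@mC n) s t); apply: coxs.
  have -> : (mC s t).*2 = k.*2 + (mC s t - k).*2 by lia.
  by rewrite altwD odd_double; exact: (cox_cat h (coxr _ _)).
case: k k2 => [|[|k]] k2 hk //= h.
  case/eqP: st; apply: cox_gen_inj.
  apply: (@coxt _ _ _ ([:: s; t] ++ [:: t])); last exact: (cox_cat h (coxr _ _)).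
  by apply: (cox_cat (coxr _ [:: s])); apply/coxs/(cox_ss mC_diag).
have m4 : mC s t = 4 by case: mCP k2 hk => *; lia.
have k0 : k = 0 by lia.
by rewrite k0 in h; exact: (end_order2 m4 h).
Qed.

Lemma braid_free_FC_typeC w :
  braid_free (@mC n) w <-> reduced (@mC n) w /\ fully_commutative (@mC n) w.
Proof. exact: (braid_free_FC mC_diag mC_sym mC_gt1 mC_order). Qed.

End TypeC.

(** * Convex braids and the shape of peaks *)

Section SeqFacts.
Variable T : eqType.
Implicit Types (p q : pred T) (s : seq T).

Lemma filter_eq_cons p s s1 c s2 : filter p s = s1 ++ c :: s2 ->
  exists u1 u2, [/\ s = u1 ++ c :: u2, filter p u1 = s1 & filter p u2 = s2].
Proof.
elim: s s1 => [|d s IH] s1 /=; first by case: s1.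
case: ifPn => pd.
  case: s1 => [[-> <-] | c1 s1 [<- /IH[u1 [u2 [-> <- <-]]]]].
    by exists [::], s.
  by exists (d :: u1), u2; rewrite /= pd.
move=> /IH[u1 [u2 [-> <- <-]]]; exists (d :: u1), u2; split=> //=.
by rewrite (negbTE pd).
Qed.

Lemma all_filter_sub p q s : (forall c, ~~ p c -> q c) ->
  all q (filter p s) = all q s.
Proof.
move=> pq; elim: s => //= c s IH; case: ifPn => pc; rewrite /= IH //.
by rewrite pq.
Qed.

Lemma split_first p s : has p s ->
  exists u1 c u2, [/\ s = u1 ++ c :: u2, p c & all (predC p) u1].
Proof.
move=> /split_find[c u1 u2 pc]; rewrite -all_predC => h.
by exists u1, c, u2; split; rewrite ?cat_rcons.
Qed.

Lemma split_mem c s : c \in s ->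
  exists u1 u2, s = u1 ++ c :: u2 /\ c \notin u1.
Proof.
rewrite -has_pred1 => /split_first[u1 [d [u2 [-> /eqP-> h]]]]; exists u1, u2.
by move: h; rewrite all_predC has_pred1.
Qed.

Lemma filter0 p s : filter p s = [::] <-> all (predC p) s.
Proof.
split=> h; first by rewrite all_predC has_filter h.
by apply/eqP; rewrite -[_ == _]negbK -has_filter -all_predC.
Qed.

End SeqFacts.

(** Letters that differ from [a] and commute with it. *)
Definition far (a : nat) : pred nat := [pred c | (c.+1 < a) || (a.+1 < c)].
Definition nbr (a b : nat) : bool := (a.+1 == b) || (b.+1 == a).

(** The three patterns in [v] are the convex chains [a a], [a b a] (with both
    letters interior, so that they satisfy a relation of length 3) and [a b a b]
    of the heap, and the [far] conditions express convexity. The last pattern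
    concerns the ends of the diagram: for interior letters it contains the
    second one. *)
Record convex_braid_free (n : nat) (v : seq nat) : Prop := ConvexBraidFree {
  no_repeat : forall x y z a, v = x ++ a :: y ++ a :: z -> ~ all (far a) y;
  no_braid3 : forall x y1 y2 z a b, v = x ++ a :: y1 ++ b :: y2 ++ a :: z ->
    nbr a b -> 0 < a < n -> 0 < b < n -> all (far a) y1 -> ~ all (far a) y2;
  no_braid4 : forall x y1 y2 y3 z a b,
    v = x ++ a :: y1 ++ b :: y2 ++ a :: y3 ++ b :: z -> nbr a b ->
    all (far a) y1 -> all (far a) y2 -> all (far b) y2 -> ~ all (far b) y3 }.

Section Patterns.
Variable n : nat.
Implicit Types (v x y z : seq nat) (a b : nat).

Lemma convex_braid_free_infix x v z : convex_braid_free n (x ++ v ++ z) -> convex_braid_free n v.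
Proof.
case=> hA hB hC; split.
- by move=> x0 y z0 a e; apply: (hA (x ++ x0) y (z0 ++ z)); rewrite e; do ?rewrite -!catA /=.
- move=> x0 y1 y2 z0 a b e; apply: (hB (x ++ x0) y1 y2 (z0 ++ z)).
  by rewrite e; do ?rewrite -!catA /=.
- move=> x0 y1 y2 y3 z0 a b e; apply: (hC (x ++ x0) y1 y2 y3 (z0 ++ z)).
  by rewrite e; do ?rewrite -!catA /=.
Qed.

Lemma nbr_sym a b : nbr a b = nbr b a.
Proof. by rewrite /nbr orbC. Qed.

Lemma convex_braid_free_rev v : convex_braid_free n v -> convex_braid_free n (rev v).
Proof.
have revE x c y : rev (x ++ c :: y) = rev y ++ c :: rev x.
  by rewrite rev_cat rev_cons cat_rcons.
case=> hA hB hC; split.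
- move=> x y z a /(canRL revK); rewrite !revE; do ?rewrite -!catA /=.
  by move=> /hA; rewrite all_rev.
- move=> x y1 y2 z a b /(canRL revK).
  rewrite !revE; do ?rewrite -!catA /=; move=> /hB h ab ha hb h1 h2.
  by apply: h ab ha hb _ _; rewrite all_rev.
- move=> x y1 y2 y3 z a b /(canRL revK).
  rewrite !revE; do ?rewrite -!catA /=; move=> /hC h ab h1 h2 h3 h4.
  by apply: h; rewrite ?all_rev // nbr_sym.
Qed.

(** The symmetry of the diagram exchanging [t] and [u]. *)
Definition mirror : seq nat -> seq nat := map (subn n).

Lemma mirrorK v : all (leq^~ n) v -> mirror (mirror v) = v.
Proof.
move=> /allP h; rewrite /mirror -map_comp -[RHS]map_id; apply/eq_in_map => c /h /=.
by lia.
Qed.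

Lemma all_mirror v : all (leq^~ n) (mirror v).
Proof. by apply/allP=> _ /mapP[c _ ->] /=; lia. Qed.

Lemma far_mirror a y : a <= n -> all (leq^~ n) y ->
  all (far a) y -> all (far (n - a)) (mirror y).
Proof.
move=> an /allP yn /allP h; apply/allP=> _ /mapP[c cy ->].
by have /= := yn _ cy; have /= := h _ cy; rewrite /far /=; lia.
Qed.

Lemma convex_braid_free_mirror v : all (leq^~ n) v ->
  convex_braid_free n v -> convex_braid_free n (mirror v).
Proof.
move=> vn [hA hB hC]; have mK := mirrorK vn.
have mE w : mirror v = w -> v = mirror w /\ all (leq^~ n) w.
  by move=> <-; split; [rewrite mK | exact: all_mirror].
split.
- move=> x y z a /mE[]; do 2 rewrite /mirror ?(map_cat, map_cons, all_cat) /=.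
  move=> /hA h /and5P[_ an yn _ _]; move/(far_mirror an yn); exact: h.
- move=> x y1 y2 z a b /mE[].
  do 3 rewrite /mirror ?(map_cat, map_cons, all_cat) /=.
  move=> /hB h /and5P[_ an yn1 _ /andP[yn2 _]] ab ha hb.
  move=> /(far_mirror an yn1) h1 /(far_mirror an yn2) h2.
  by apply: h h1 h2; move: ab; rewrite /nbr; lia.
- move=> x y1 y2 y3 z a b /mE[].
  do 4 rewrite /mirror ?(map_cat, map_cons, all_cat) /=.
  move=> /hC h /and5P[_ an yn1 bn /and4P[yn2 _ yn3 _]] ab.
  move=> /(far_mirror an yn1) h1 h2 /(far_mirror bn yn2) h3 /(far_mirror bn yn3).
  by apply: h h1 (far_mirror an yn2 h2) h3; move: ab an bn; rewrite /nbr /=; lia.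
Qed.

Section Filtered.
Variables (v : seq nat) (gv : convex_braid_free n v) (p : pred nat).

(** Patterns may be looked for in the subword of the letters in [p], provided
    that [p] keeps all the letters that could obstruct convexity. *)
Lemma no_repeat_filter x y z a : filter p v = x ++ a :: y ++ a :: z ->
  (forall c, ~~ p c -> far a c) -> ~ all (far a) y.
Proof.
move=> /filter_eq_cons[x' [v' [ev _ /filter_eq_cons[y' [z' [ev' ey _]]]]]] pa.
by rewrite -ey all_filter_sub //; apply: (no_repeat gv (x := x') (z := z')); rewrite ev ev'.
Qed.

Lemma no_braid3_filter x y1 y2 z a b :
  filter p v = x ++ a :: y1 ++ b :: y2 ++ a :: z -> nbr a b ->
  0 < a < n -> 0 < b < n -> (forall c, ~~ p c -> far a c) ->
  all (far a) y1 -> ~ all (far a) y2.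
Proof.
move=> /filter_eq_cons[x' [v1 [ev _ /filter_eq_cons[y1' [v2 [ev1 <-]]]]]].
move=> /filter_eq_cons[y2' [v3 [ev2 <- _]]] ab ha hb pa.
rewrite !all_filter_sub //; apply: (no_braid3 gv _ ab ha hb).
by rewrite ev ev1 ev2.
Qed.

Lemma no_braid4_filter x y1 y2 y3 z a b :
  filter p v = x ++ a :: y1 ++ b :: y2 ++ a :: y3 ++ b :: z -> nbr a b ->
  (forall c, ~~ p c -> far a c && far b c) ->
  all (far a) y1 -> all (far a) y2 -> all (far b) y2 -> ~ all (far b) y3.
Proof.
move=> /filter_eq_cons[x' [v1 [ev _ /filter_eq_cons[y1' [v2 [ev1 <-]]]]]].
move=> /filter_eq_cons[y2' [v3 [ev2 <-]]] /filter_eq_cons[y3' [v4 [ev3 <- _]]] ab pab.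
have pa c : ~~ p c -> far a c by move/pab/andP=> [].
have pb c : ~~ p c -> far b c by move/pab/andP=> [].
rewrite !all_filter_sub //.
by apply: (no_braid4 gv _ ab); rewrite ev ev1 ev2 ev3.
Qed.

End Filtered.

(** The peak [k, ..., 1, 0, 1, ..., k], in a form suited to induction from the
    inside. *)
Fixpoint lpeak (k : nat) : seq nat :=
  if k is k'.+1 then k :: rcons (lpeak k') k else [:: 0].

Lemma iota_rcons i k : iota i k.+1 = rcons (iota i k) (i + k).
Proof. by rewrite -addn1 iotaD cats1. Qed.

Lemma lpeakE k : lpeak k = rev (iota 1 k) ++ iota 0 k.+1.
Proof.
elim: k => // k IH; rewrite [lpeak _]/= IH (iota_rcons 1 k) rev_rcons (iota_rcons 0 k.+1).
by rewrite cat_cons rcons_cat.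
Qed.

Lemma rev_lpeak k : rev (lpeak k) = lpeak k.
Proof. by elim: k => //= k IH; rewrite rev_cons rev_rcons IH. Qed.

Lemma lpeak_le k : all (leq^~ k) (lpeak k).
Proof.
rewrite lpeakE all_cat all_rev; apply/andP.
by split; apply/allP=> c; rewrite mem_iota /=; lia.
Qed.

Lemma lpeak_last k : exists s, lpeak k = rcons s k.
Proof. by case: k => [|k]; [exists [::] | exists (k.+1 :: lpeak k)]. Qed.

(** If [0 < i < a], then between the last [i] of the peak and the new one there
    is a single [i.+1] and no [i.-1], which makes a convex [i, i.+1, i]. If [i =
    0], the end of the peak and the new letter make a convex [1, 0, 1, 0]. *)
Lemma first_after_peak v x A y i z a : convex_braid_free n v -> v = x ++ A ++ y ++ i :: z ->
  0 < a < n -> filter (leq^~ a.+1) A = lpeak a -> all (ltn a) y -> i <= a -> i = a.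
Proof.
move=> gv ev ha fA ya; rewrite leq_eqVlt => /predU1P[//|ia]; exfalso.
have {}gv : convex_braid_free n (A ++ y ++ [:: i]).
  apply: (@convex_braid_free_infix x _ z); rewrite ev in gv.
  by move: gv; do ?rewrite -!catA /=.
set y' := filter (leq^~ a.+1) y.
have y'E : all (pred1 a.+1) y'.
  apply/allP=> c; rewrite mem_filter => /andP[h /(allP ya)] /=; lia.
have fE : filter (leq^~ a.+1) (A ++ y ++ [:: i]) = lpeak a ++ y' ++ [:: i].
  by rewrite !filter_cat fA /= ifT //; lia.
have [i0 | i0] := posnP i.
  have lE : lpeak a = rev (iota 2 a.-1) ++ [:: 1, 0, 1 & iota 2 a.-1].
    by case: (a) ha => // a' _; rewrite lpeakE /= rev_cons cat_rcons.
  have := @no_braid4_filter _ gv (leq^~ a.+1) (rev (iota 2 a.-1)) [::] [::]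
    (iota 2 a.-1 ++ y') [::] 1 0.
  case=> //; first by rewrite fE lE i0; do ?rewrite -!catA /=.
    by move=> c; rewrite /far /=; lia.
  rewrite all_cat; apply/andP; split; apply/allP=> c.
    by rewrite mem_iota /far /=; lia.
  by move/(allP y'E) => /= /eqP ->; rewrite /far /=; lia.
have iE : iota 0 a.+1 = iota 0 i ++ i :: i.+1 :: iota i.+2 (a - i).-1.
  have -> : a.+1 = i + (a - i).-1.+2 by lia.
  by rewrite iotaD.
have := @no_braid3_filter _ gv (leq^~ a.+1) (rev (iota 1 a) ++ iota 0 i) [::]
    (iota i.+2 (a - i).-1 ++ y') [::] i i.+1.
case=> //.
- by rewrite fE lpeakE iE; do ?rewrite -!catA /=.
- by rewrite /nbr eqxx.
- lia.
- lia.
- by move=> c; rewrite /far /=; lia.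
rewrite all_cat; apply/andP; split; apply/allP=> c.
  by rewrite mem_iota /far /=; lia.
by move/(allP y'E) => /= /eqP ->; rewrite /far /=; lia.
Qed.

(** By [first_after_peak] the first letter [<= a] would be [a]; as [a.+1] is
    absent, it would follow the last [a] of the peak without any obstruction. *)
Lemma none_after_peak v x A y z a : convex_braid_free n v -> v = x ++ A ++ y ++ z ->
  0 < a < n -> filter (leq^~ a.+1) A = lpeak a -> a.+1 \notin y ->
  all (ltn a) y.
Proof.
move=> gv ev ha fA ya; apply/negPn/negP; rewrite -has_predC.
move=> /split_first[y1 [i [y2 [ey /= ia]]]] hy1.
have {}hy1 : all (ltn a) y1 by apply: sub_all hy1 => c /=; lia.
have ei : i = a.
  apply: (@first_after_peak v x A y1 i (y2 ++ z) a) => //; last lia.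
  by rewrite ev ey; do ?rewrite -!catA /=.
rewrite {i}ei in ey ia.
have {}gv : convex_braid_free n (A ++ y1 ++ [:: a]).
  apply: (@convex_braid_free_infix x _ (y2 ++ z)); rewrite ev ey in gv.
  by move: gv; do ?rewrite -!catA /=.
have fy1 : filter (leq^~ a.+1) y1 = [::].
  apply/filter0/allP=> c cy1 /=; have := allP hy1 _ cy1 => /=.
  have : c != a.+1; last by lia.
  by apply: contraNneq ya => <-; rewrite ey mem_cat cy1.
have [s es] := lpeak_last a.
have fE : filter (leq^~ a.+1) (A ++ y1 ++ [:: a]) = s ++ a :: [::] ++ [:: a].
  by rewrite !filter_cat fA fy1 es /= leqnSn cat_rcons.
by case: (no_repeat_filter gv fE) => // c; rewrite /far /=; lia.
Qed.

Lemma filter_peak_block y a : 0 < a -> a \notin y -> a.+1 \notin y ->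
  filter (ltn^~ a) y = lpeak a.-1 -> filter (leq^~ a.+1) (a :: rcons y a) = lpeak a.
Proof.
move=> a0 ya ya1 fy; rewrite /= leqnSn filter_rcons leqnSn.
rewrite (_ : filter _ y = lpeak a.-1); first by case: (a) a0.
rewrite -fy; apply: eq_in_filter => c cy /=.
have ca : c != a by apply: contraNneq ya => <-.
have ca1 : c != a.+1 by apply: contraNneq ya1 => <-.
by rewrite leq_eqVlt (negbTE ca1) ltnS leq_eqVlt (negbTE ca).
Qed.

(** Induction on [a]. Since [a.+1] is absent, [y] has to contain [a.-1] at least
    twice. Between the first two of them the induction hypothesis gives the
    smaller peak, and there is nothing below [a] outside it by [none_after_peak]
    applied to [v] and to its reversal. *)
Lemma between_lpeak v x y z a : convex_braid_free n v -> v = x ++ a :: y ++ a :: z ->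
  0 < a < n -> a \notin y -> a.+1 \notin y -> filter (ltn^~ a) y = lpeak a.-1.
Proof.
elim: a v x y z => [//|a IH] v x y z gv ev ha ya ya1.
have [a0 | a0] := posnP a.
  rewrite {a IH}a0 in ev ha ya ya1 *; rewrite /=.
  have y0 : 0 \in y.
    apply/negPn/negP => y0; case: (no_repeat gv ev).
    apply/allP=> c cy; rewrite /far /=.
    by case: c cy => [|[|[|c]]] // cy; move: y0 ya ya1; rewrite cy.
  have [y1 [y2 [ey y10]]] := split_mem y0.
  have f1 : filter (ltn^~ 1) y1 = [::].
    by apply/filter0/allP=> c cy /=; case: c cy (negP y10) => //= ->.
  have f2 : filter (ltn^~ 1) y2 = [::].
    apply/filter0/allP=> c cy /=; case: c cy => //= /split_mem[y3 [y4 [ey2 y30]]].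
    case: (@no_repeat _ _ gv (x ++ 1 :: y1) y3 (y4 ++ 1 :: z) 0).
      by rewrite ev ey ey2; do ?rewrite -!catA /=.
    apply/allP=> c cy; rewrite /far /=; case: c cy => [|[|c]] // cy.
      by move: y30; rewrite cy.
    by move: ya; rewrite ey ey2 !(mem_cat, inE) cy !orbT.
  by rewrite ey filter_cat /= f1 f2.
have yfar u : {subset u <= y} -> a \notin u -> all (far a.+1) u.
  move=> uy ua; apply/allP=> c cu; rewrite /far /=.
  have [ca ca1 ca2] : [/\ c != a, c != a.+1 & c != a.+2].
    split; first by apply: contraNneq ua => <-.
      by apply: contraNneq ya => <-; exact: uy.
    by apply: contraNneq ya1 => <-; exact: uy.
  by lia.
have ay : a \in y.
  by apply/negPn/negP => ay; exact: (no_repeat gv ev (yfar y _ ay)).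
have [y1 [y' [ey y1a]]] := split_mem ay.
have ay' : a \in y'.
  apply/negPn/negP => ay'; rewrite ey -catA /= in ev.
  case: (no_braid3 gv ev _ _ _ (yfar y1 _ y1a) (yfar y' _ ay')) => //; try lia.
  - by rewrite /nbr; lia.
  - by move=> c cy; rewrite ey mem_cat cy.
  - by move=> c cy; rewrite ey mem_cat inE cy !orbT.
have [y2 [y3 [ey' y2a]]] := split_mem ay'.
have hf : filter (ltn^~ a) y2 = lpeak a.-1.
  apply: (IH v (x ++ a.+1 :: y1) y2 (y3 ++ a.+1 :: z)) => //; last 2 first.
  - lia.
  - by apply: contra ya; rewrite ey ey' !(mem_cat, inE) => ->; rewrite !orbT.
  by rewrite ev ey ey'; do ?rewrite -!catA /=.
have y2a1 : a.+1 \notin y2.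
  by apply: contra ya; rewrite ey ey' !(mem_cat, inE) => ->; rewrite !orbT.
have fA := filter_peak_block a0 y2a y2a1 hf.
have ya_1 : a.+1 \notin y1 by apply: contra ya; rewrite ey mem_cat => ->.
have ya_3 : a.+1 \notin y3.
  by apply: contra ya; rewrite ey ey' !(mem_cat, inE) => ->; rewrite !orbT.
have ha' : 0 < a < n by lia.
have hy3 : all (ltn a) y3.
  apply: (@none_after_peak v (x ++ a.+1 :: y1) (a :: rcons y2 a) y3 (a.+1 :: z)) => //.
  by rewrite ev ey ey' -cats1; do ?rewrite -!catA /=.
have hy1 : all (ltn a) y1.
  rewrite -all_rev; apply: (@none_after_peak (rev v) (rev (y3 ++ a.+1 :: z))
    (rev (a :: rcons y2 a)) _ (rev (x ++ [:: a.+1]))) => //.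
  - exact: convex_braid_free_rev.
  - rewrite -!rev_cat ev ey ey' -cats1; congr rev.
    by do ?rewrite -!catA /=.
  - by rewrite filter_rev fA rev_lpeak.
  - by rewrite mem_rev.
have f0 u : all (ltn a) u -> filter (ltn^~ a.+1) u = [::].
  by move=> hu; apply/filter0; apply: sub_all hu => c /=; rewrite ltnS -ltnNge.
have f2 : filter (ltn^~ a.+1) y2 = lpeak a.-1.
  rewrite -hf; apply: eq_in_filter => c cy /=.
  by rewrite ltnS leq_eqVlt; case: eqP cy y2a => // -> ->.
have -> : y = y1 ++ [:: a] ++ y2 ++ [:: a] ++ y3 by rewrite ey ey'.
rewrite !filter_cat (f0 y1) // (f0 y3) // f2 /= ltnSn cats1.
by case: (a) a0.
Qed.
End Patterns.

(** * Zigzags *)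

(** The letter at position [p] of the infinite word [0 1 ... n (n-1) ... 1 0 1
    ...]. *)
Definition zigzag (n p : nat) : nat :=
  let r := p %% n.*2 in if r <= n then r else n.*2 - r.

Definition zigrun (n p len : nat) : seq nat := map (zigzag n) (iota p len).

Section Zigzag.
Variables (n : nat) (hn : 1 < n).
Implicit Types (v x y z : seq nat) (a b p : nat).

Lemma zigzag_up M i : i <= n -> zigzag n (M * n.*2 + i) = i.
Proof. by move=> hi; rewrite /zigzag modnMDl modn_small ?hi //; lia. Qed.

Lemma zigzag_down M i : i <= n -> zigzag n (M * n.*2 + n + i) = n - i.
Proof.
move=> hi; rewrite /zigzag -addnA modnMDl.
have [->|ni] := eqVneq i n; first by rewrite addnn modnn subnn.
by rewrite modn_small; [case: ifP; lia | lia].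
Qed.

Variant zigzag_spec p : nat -> Prop :=
  | ZigUp M i of p = M * n.*2 + i & i < n : zigzag_spec p i
  | ZigDown M i of p = M * n.*2 + n + i & i < n : zigzag_spec p (n - i).

Lemma zigzagP p : zigzag_spec p (zigzag n p).
Proof.
have n2 : 0 < n.*2 by lia.
have hr := ltn_pmod p n2; have hp := divn_eq p n.*2.
set M := p %/ _ in hp; set r := p %% _ in hp hr.
case: (ltnP r n) => rn.
  by rewrite hp zigzag_up; [apply: (@ZigUp _ M r) | lia].
have hp' : p = M * n.*2 + n + (r - n) by lia.
by rewrite hp' zigzag_down; [apply: (@ZigDown _ M (r - n)) => //; lia | lia].
Qed.

Lemma zigzag_le p : zigzag n p <= n.
Proof. by case: zigzagP => *; lia. Qed.

Lemma zigzag_mirror p : zigzag n (p + n) = n - zigzag n p.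
Proof.
case: (zigzagP p) => M i -> hi.
  by rewrite addnAC zigzag_down //; lia.
by have -> : M * n.*2 + n + i + n = M.+1 * n.*2 + i; [lia | rewrite zigzag_up; lia].
Qed.

Lemma zigzag_rev K p : p <= K * n.*2 -> zigzag n (K * n.*2 - p) = zigzag n p.
Proof.
case: (zigzagP p) => M i -> hi hK.
  have [i0 | i0] := posnP i.
    rewrite i0 addn0 -mulnBl -[_ * _]addn0 zigzag_up //.
  have -> : K * n.*2 - (M * n.*2 + i) = (K - M.+1) * n.*2 + n + (n - i).
    have : M.+1 * n.*2 <= K * n.*2 by rewrite leq_mul2r; nia.
    by rewrite mulnBl; lia.
  by rewrite zigzag_down; lia.
have hM : M.+1 * n.*2 <= K * n.*2 by rewrite leq_mul2r; nia.
have -> : K * n.*2 - (M * n.*2 + n + i) = (K - M.+1) * n.*2 + (n - i).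
  by rewrite mulnBl; lia.
by rewrite zigzag_up; lia.
Qed.

Lemma zigzagS p : nbr (zigzag n p) (zigzag n p.+1).
Proof.
rewrite /nbr; case: (zigzagP p) => M i -> hi; rewrite -addnS.
  by rewrite zigzag_up; lia.
by rewrite zigzag_down; lia.
Qed.

Lemma zigzag_turn p : zigzag n p = zigzag n p.+2 ->
  (zigzag n p.+1 == 0) || (zigzag n p.+1 == n).
Proof.
case: (zigzagP p) => M i -> hi; rewrite -!addnS.
  rewrite (zigzag_up M hi); have [hi2|hi2] := leqP i.+2 n.
    by rewrite zigzag_up //; lia.
  by lia.
rewrite (zigzag_down M hi); have [hi2|hi2] := leqP i.+2 n.
  by rewrite zigzag_down //; lia.
by lia.
Qed.

Lemma zigrun_cat p k l : zigrun n p (k + l) = zigrun n p k ++ zigrun n (p + k) l.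
Proof. by rewrite /zigrun iotaD map_cat. Qed.

Lemma size_zigrun p k : size (zigrun n p k) = k.
Proof. by rewrite size_map size_iota. Qed.

Lemma mirror_zigrun p k : mirror n (zigrun n p k) = zigrun n (p + n) k.
Proof.
rewrite /mirror /zigrun -map_comp addnC iotaDl -map_comp; apply: eq_map => i /=.
by rewrite addnC zigzag_mirror.
Qed.

Lemma rev_zigrun p k : exists q, rev (zigrun n p k) = zigrun n q k.
Proof.
(* Zigzags are symmetric around the multiples of their period. *)
exists ((p + k) * n.*2 - (p + k).-1); apply: (@eq_from_nth _ 0).
  by rewrite size_rev !size_zigrun.
move=> i; rewrite size_rev size_zigrun => ik.
rewrite nth_rev ?size_zigrun // !(nth_map 0) ?size_iota ?nth_iota //; try lia.
rewrite -(@zigzag_rev (p + k)); last by nia.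
by congr zigzag; nia.
Qed.

Lemma zigrun_up M i k : i + k <= n.+1 -> zigrun n (M * n.*2 + i) k = iota i k.
Proof.
move=> ik; rewrite /zigrun iotaDl -map_comp -[RHS]map_id; apply/eq_in_map => j.
by rewrite mem_iota /= => hj; rewrite zigzag_up //; lia.
Qed.

Lemma zigrun_down M i k : i + k <= n.+1 ->
  zigrun n (M * n.*2 + n + i) k = [seq n - j | j <- iota i k].
Proof.
move=> ik; rewrite /zigrun iotaDl -map_comp; apply/eq_in_map => j.
by rewrite mem_iota /= => hj; rewrite zigzag_down //; lia.
Qed.

(** Any other letter [b] creates a forbidden pattern with its previous
    occurrence: in the descent [n, ..., n - d] if [b >= n - d], or else in the
    ascent [0, ..., n]. The letter 1 in front is needed when [b = 0], to
    complete the pattern [1, 0, 1, 0]. *)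
Lemma zigzag_next_down x z d b : d < n -> b <= n ->
  convex_braid_free n (x ++ 1 :: iota 0 n.+1 ++ [seq n - i | i <- iota 1 d] ++ b :: z) ->
  b = n - d.+1.
Proof.
move=> dn bn gv; apply/eqP/negPn/negP => hb.
have [bc | bc] := leqP (n - d) b; last first.
  have [b0 | b0] := posnP b.
    apply: (@no_braid4 _ _ gv x [::] [::] (iota 2 n.-1 ++ [seq n - i | i <- iota 1 d]) z 1 0) => //.
      have -> : iota 0 n.+1 = [:: 0, 1 & iota 2 n.-1] by case: (n) hn.
      by rewrite b0; do ?rewrite -!catA /=.
    rewrite all_cat; apply/andP; split; apply/allP=> c.
      by rewrite mem_iota /far /=; lia.
    by move=> /mapP[j]; rewrite mem_iota /far /= => hj ->; lia.
  apply: (@no_braid3 _ _ gv (x ++ 1 :: iota 0 b) [::]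
    (iota b.+2 (n - b.+1) ++ [seq n - i | i <- iota 1 d]) z b b.+1) => //; try lia.
  - have -> : iota 0 n.+1 = iota 0 b ++ [:: b, b.+1 & iota b.+2 (n - b.+1)].
      have e2 : n.+1 = b + (n - b.+1).+2 by lia.
      by rewrite {1}e2 iotaD.
    by do ?rewrite -!catA /=.
  - by rewrite /nbr eqxx.
  - rewrite all_cat; apply/andP; split; apply/allP=> c.
      by rewrite mem_iota /far /=; lia.
    by move=> /mapP[j]; rewrite mem_iota /far /= => hj ->; lia.
set e := n - b; have be : b = n - e by lia.
have [ed | ed] := eqVneq e d.
  rewrite be ed in gv; case: d {dn hb bc ed be} gv => [|d] gv.
    apply: (@no_repeat _ _ gv (x ++ 1 :: iota 0 n) [::] z n) => //.
    by rewrite subn0 iota_rcons -cats1; do ?rewrite -!catA /=.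
  apply: (@no_repeat _ _ gv
    (x ++ 1 :: iota 0 n.+1 ++ [seq n - i | i <- iota 1 d]) [::] z (n - d.+1)) => //.
  by rewrite (iota_rcons 1 d) map_rcons -cats1; do ?rewrite -!catA /=.
have {}ed : e < d by lia.
have [e0 | e0] := posnP e.
  apply: (@no_braid4 _ _ gv (x ++ 1 :: iota 0 n.-1) [::] [::]
    [seq n - i | i <- iota 2 d.-1] z n.-1 n) => //.
  - have -> : iota 0 n.+1 = iota 0 n.-1 ++ [:: n.-1; n].
      have e2 : n.+1 = n.-1 + 2 by lia.
      by rewrite {1}e2 iotaD /= add0n (ltn_predK hn).
    have -> : iota 1 d = 1 :: iota 2 d.-1 by case: (d) ed.
    by rewrite be e0 subn0 /= subn1; do ?rewrite -!catA /=.
  - by rewrite /nbr; lia.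
  - by apply/allP=> c /mapP[j]; rewrite mem_iota /far /= => hj ->; lia.
apply: (@no_braid3 _ _ gv
  (x ++ 1 :: iota 0 n.+1 ++ [seq n - i | i <- iota 1 e.-1]) [::]
  [seq n - i | i <- iota e.+2 (d - e.+1)] z b (n - e.+1)) => //; try lia.
- have -> : iota 1 d = iota 1 e.-1 ++ [:: e, e.+1 & iota e.+2 (d - e.+1)].
    have e2 : d = e.-1 + (d - e.+1).+2 by lia.
    by rewrite {1}e2 iotaD add1n prednK.
  by rewrite map_cat /= -be; do ?rewrite -!catA /=.
- by rewrite /nbr; lia.
- by apply/allP=> c /mapP[j]; rewrite mem_iota /far /= => hj ->; lia.
Qed.

(** More than a period is known before [b], so that the previous lemma applies;
    ascents are mirror images of descents. *)
Lemma zigzag_next x p k z b : n.*2 < k -> all (leq^~ n) (x ++ zigrun n p k ++ b :: z) ->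
  convex_braid_free n (x ++ zigrun n p k ++ b :: z) -> b = zigzag n (p + k).
Proof.
move=> hk; wlog [M [d [hpk hd]]] : x p z b / exists M d, p + k = M * n.*2 + n + d.+1 /\ d < n.
  move=> W hle gv.
  have bn : b <= n by move: hle; rewrite !all_cat /= => /and4P[].
  have : 0 < p + k by lia.
  case E : (p + k) => [//|q] _; have [M d eq hd | M d eq hd] := zigzagP q; last first.
    by rewrite -E; apply: W hle gv; exists M, d; rewrite E eq addnS.
  have mE : mirror n (x ++ zigrun n p k ++ b :: z)
      = mirror n x ++ zigrun n (p + n) k ++ (n - b) :: mirror n z.
    by rewrite -mirror_zigrun /mirror !map_cat.
  have := W (mirror n x) (p + n) (mirror n z) (n - b); rewrite -mE.
  rewrite (_ : p + n + k = p + k + n); last lia.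
  rewrite zigzag_mirror => h; rewrite -E.
  suff: n - b = n - zigzag n (p + k) by have := zigzag_le (p + k); lia.
  apply: h; [|exact: all_mirror | exact: convex_braid_free_mirror].
  by exists M, d; rewrite E eq; split=> //; lia.
move=> hle gv; rewrite hpk zigzag_down //.
have bn : b <= n by move: hle; rewrite !all_cat /= => /and4P[].
have M0 : 0 < M by nia.
(* The last letters are 1, the whole ascent from 0 to n, and d letters of descent. *)
have hl : k = (k - (n + d).+2) + (1 + (n.+1 + d)) by lia.
rewrite hl 3!zigrun_cat in gv.
have e1 : p + (k - (n + d).+2) = M.-1 * n.*2 + n + n.-1.
  have : M * n.*2 = M.-1 * n.*2 + n.*2 by rewrite addnC -mulSn prednK.
  lia.
have e2 : p + (k - (n + d).+2) + 1 = M * n.*2 + 0.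
  have : M * n.*2 = M.-1 * n.*2 + n.*2 by rewrite addnC -mulSn prednK.
  lia.
have e3 : p + (k - (n + d).+2) + 1 + n.+1 = M * n.*2 + n + 1.
  by rewrite e2; lia.
rewrite e3 e2 e1 !(zigrun_down, zigrun_up) in gv; try lia.
apply: (@zigzag_next_down (x ++ zigrun n p (k - (n + d).+2)) z d b) => //.
have n1 : n - n.-1 = 1 by lia.
by move: gv; rewrite /= n1; do ?rewrite -!catA /=.
Qed.

Lemma zigzag_extend x p k z : n.*2 < k -> all (leq^~ n) (x ++ zigrun n p k ++ z) ->
  convex_braid_free n (x ++ zigrun n p k ++ z) -> z = zigrun n (p + k) (size z).
Proof.
elim: z k => //= b z IH k hk hle gv.
have eb := zigzag_next hk hle gv.
have e : zigrun n p k ++ b :: z = zigrun n p k.+1 ++ z.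
  by rewrite -[k.+1]addn1 zigrun_cat -catA /= eb.
rewrite /zigrun /= -eb; congr (_ :: _); rewrite e in hle gv.
by rewrite [LHS](IH k.+1) // -?addnS //; lia.
Qed.

Lemma zigzag_whole x p k z : n.*2 < k -> all (leq^~ n) (x ++ zigrun n p k ++ z) ->
  convex_braid_free n (x ++ zigrun n p k ++ z) ->
  exists q, x ++ zigrun n p k ++ z = zigrun n q (size (x ++ zigrun n p k ++ z)).
Proof.
move=> hk hle gv; have ez := zigzag_extend hk hle gv; set l := size z in ez.
rewrite ez -zigrun_cat in hle gv *.
have [q eq] := rev_zigrun p (k + l).
have hrev : rev (x ++ zigrun n p (k + l)) = [::] ++ zigrun n q (k + l) ++ rev x.
  by rewrite rev_cat eq.
have := @zigzag_extend [::] q (k + l) (rev x); rewrite -hrev.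
rewrite all_rev => /(_ _ hle (convex_braid_free_rev gv)) h.
have {}h : rev x = zigrun n (q + (k + l)) (size (rev x)) by apply: h; lia.
have [q' eq'] := rev_zigrun q (k + l + size x).
exists q'; rewrite -[LHS]revK hrev /= h size_rev -zigrun_cat eq'.
by rewrite size_cat size_zigrun addnC.
Qed.

Lemma lpeak_zigrun a : a <= n -> lpeak a = zigrun n (n.*2 - a) a.*2.+1.
Proof.
elim: a => [|a IH] ha.
  by rewrite subn0 /zigrun /= -[n.*2]mul1n -[_ * _]addn0 zigzag_up.
rewrite [lpeak _]/= IH; last lia.
rewrite doubleS -[a.*2.+3]addn1 -[a.*2.+2]add1n 2!zigrun_cat -cats1.
have -> : n.*2 - a.+1 + 1 = n.*2 - a by lia.
have -> : n.*2 - a.+1 + (1 + a.*2.+1) = 1 * n.*2 + a.+1 by lia.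
have -> : n.*2 - a.+1 = 0 * n.*2 + n + (n - a.+1) by lia.
by rewrite {1}/zigrun /zigrun /= zigzag_down ?zigzag_up ?subKn //; lia.
Qed.

Lemma turn_zigrun a : 0 < a < n ->
  lpeak a ++ mirror n (lpeak (n - a.+1)) ++ [:: a] = zigrun n (n.*2 - a) n.*2.+1.
Proof.
move=> ha; rewrite lpeak_zigrun; last lia.
rewrite lpeak_zigrun; last lia.
rewrite mirror_zigrun.
have -> : n.*2.+1 = a.*2.+1 + ((n - a.+1).*2.+1 + 1) by lia.
rewrite !zigrun_cat; congr (_ ++ (zigrun n _ _ ++ _)); first by lia.
have -> : n.*2 - a + a.*2.+1 + (n - a.+1).*2.+1 = 1 * n.*2 + n + (n - a) by lia.
by rewrite /zigrun /= zigzag_down ?subKn //; lia.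
Qed.

Definition ZZword v :=
  (exists p, v = zigrun n p (size v)) /\ exists i, 0 < i < n /\ 3 <= count_mem i v.

(** The first letter [<= a] of [z] is [a] by [first_after_peak]. So there is a
    right peak after the left peak, their union is a contiguous full turn of the
    zigzag by [first_after_peak] seen in the mirror and backwards, and
    [zigzag_whole] concludes. Three letters [a] take part in the turn. *)
Lemma half_turn v x y z a : all (leq^~ n) v -> convex_braid_free n v ->
  v = x ++ a :: y ++ a :: z -> 0 < a < n -> a \notin y -> a.+1 \notin y ->
  has (leq^~ a) z -> ZZword v.
Proof.
move=> hv gv ev ha ya ya1 /split_first[z1 [i [z2 [ez ia z1a]]]].
have {}z1a : all (ltn a) z1 by apply: sub_all z1a => c /=; rewrite ltnNge.
have ly := between_lpeak gv ev ha ya ya1.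
have a0 : 0 < a by lia.
have lay := filter_peak_block a0 ya ya1 ly.
have {ia}ei : i = a.
  apply: (@first_after_peak n v x (a :: rcons y a) z1 i z2 a) => //.
  by rewrite ev ez -cats1 /= -catA.
rewrite {i}ei in ez.
pose m := n - a; have mE : a = n - m by rewrite subKn //; lia.
have vE : mirror n v = mirror n (x ++ a :: y) ++ m :: mirror n z1 ++ m :: mirror n z2.
  rewrite ev ez /mirror /m !map_cat /= !map_cat /= map_cat /=.
  by do ?rewrite -!catA /=.
have gm := convex_braid_free_mirror hv gv.
have [hy hz1] : all (leq^~ n) y /\ all (leq^~ n) z1.
  move: hv; rewrite ev ez; do 4 rewrite ?all_cat /=.
  by move=> /and5P[_ _ -> _ /andP[->]].
have hm : 0 < m < n by lia.
have mz1 : mirror n z1 = lpeak m.-1.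
  rewrite -(between_lpeak gm vE hm).
  - apply/esym/all_filterP/allP=> _ /mapP[c cz ->] /=.
    by have := allP z1a _ cz; have := allP hz1 _ cz; rewrite /= /m; lia.
  - apply/mapP=> -[c cz]; have := allP z1a _ cz; have := allP hz1 _ cz.
    by rewrite /= /m; lia.
  - apply/mapP=> -[c cz]; have := allP z1a _ cz; have := allP hz1 _ cz.
    by rewrite /= /m; lia.
have z1E : z1 = mirror n (lpeak (n - a.+1)).
  by rewrite -(mirrorK hz1) mz1 /m; congr (mirror n (lpeak _)); lia.
have yE : y = lpeak a.-1.
  rewrite -ly; apply/esym/all_filterP/negPn/negP; rewrite -has_predC -has_rev.
  rewrite (_ : has _ _ = has (leq^~ m) (rev (mirror n y))); last first.
    rewrite !has_rev has_map; apply: eq_in_has => c cy /=.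
    by have := allP hy _ cy; rewrite /= /m; lia.
  move=> /split_first[y1 [j [y2 [ey jm y1m]]]].
  have ej : j = m.
    apply: (@first_after_peak n (rev (mirror n v)) (rev (mirror n z2)) (lpeak m)
      y1 j (y2 ++ rev (mirror n (x ++ [:: a]))) m) => //.
    - exact: convex_braid_free_rev.
    - have -> : v = (x ++ [:: a]) ++ y ++ (a :: rcons z1 a) ++ z2.
        by rewrite ev ez -cats1; do 3 rewrite -?catA /=.
      have mA : mirror n (a :: rcons z1 a) = lpeak m.
        by rewrite /mirror /= map_rcons -/(mirror n z1) mz1 -/m; case: (m) hm.
      rewrite {1}/mirror !map_cat -!/(mirror n _) mA -map_cat !rev_cat rev_lpeak ey.
      by do 3 rewrite -?catA /=.
    - apply/all_filterP; apply: sub_all (lpeak_le m) => c /=; exact: leqW.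
    - by apply: sub_all y1m => c /=; rewrite ltnNge.
  case/negP: ya; rewrite mE -(mirrorK hy); apply: map_f.
  by rewrite -mem_rev ey ej mem_cat mem_head orbT.
have fullE : v = x ++ zigrun n (n.*2 - a) n.*2.+1 ++ z2.
  rewrite -turn_zigrun // ev ez z1E yE.
  have -> : lpeak a = a :: rcons (lpeak a.-1) a by case: (a) ha.
  by rewrite -cats1; do ?rewrite -!catA /=.
split; last first.
  exists a; split=> //; rewrite ev ez !count_cat /= count_cat /= count_cat /= eqxx.
  lia.
by rewrite fullE in hv gv *; exact: zigzag_whole.
Qed.

End Zigzag.

(** * Classification of the words without convex braids *)

(** Alternation fails on the edge [i, j] by two consecutive letters [i]. *)
Definition repeats (v : seq nat) (i j : nat) : bool :=
  infix [:: i; i] (filter (pred2 i j) v).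

Lemma infix2P (T : eqType) (s : seq T) c d :
  reflect (exists x y, s = x ++ [:: c, d & y]) (infix [:: c; d] s).
Proof. exact: (@infixP T [:: c; d] s). Qed.

Lemma infix2_wrap (T : eqType) (c : T) s :
  s != [::] -> c \notin s -> ~~ infix [:: c; c] (c :: rcons s c).
Proof.
move=> s0 cs; apply/infix2P => -[[|d x] [y]].
  by case: s s0 cs => //= d s _ + [ed]; rewrite -ed inE eqxx.
case=> _ {d}; elim/last_ind: y => [|y d _].
  rewrite -[[:: c; c]]/(rcons [:: c] c) -rcons_cat => /rcons_inj[es].
  by rewrite es mem_cat mem_head orbT in cs.
rewrite -!rcons_cons -rcons_cat => /rcons_inj[es].
by rewrite es mem_cat mem_head orbT in cs.
Qed.

Lemma repeatsP v i j : reflect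
  (exists x y z, [/\ v = x ++ i :: y ++ i :: z, i \notin y & j \notin y]) (repeats v i j).
Proof.
apply: (iffP (infix2P _ _ _)) => [[s [t]]|[x [y [z [-> yi yj]]]]].
  move=> /filter_eq_cons[x [w [-> _]]].
  rewrite -[i :: t]/([::] ++ i :: t) => /filter_eq_cons[y [z [-> /filter0 yf _]]].
  exists x, y, z; split=> //; apply/negP=> /(allP yf) /=; rewrite eqxx ?orbT //.
exists (filter (pred2 i j) x), (filter (pred2 i j) z).
rewrite filter_cat /= eqxx /= filter_cat /= eqxx /=.
rewrite (_ : filter _ y = [::]) //; apply/filter0/allP=> c cy /=.
by rewrite negb_or; apply/andP; split; [apply: contraNneq yi | apply: contraNneq yj] => <-.
Qed.

Lemma lpeak_filter i j : i <= j -> filter (leq^~ i) (lpeak j) = lpeak i.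
Proof.
elim: j => [|j IH]; first by rewrite leqn0 => /eqP ->.
rewrite leq_eqVlt => /predU1P[->|ij].
  by apply/all_filterP; exact: lpeak_le.
by rewrite /= filter_rcons leqNgt ij /= IH.
Qed.

Lemma mem_lpeak i j : (i \in lpeak j) = (i <= j).
Proof.
apply/idP/idP => [/(allP (lpeak_le j)) //|ij].
by rewrite lpeakE mem_cat mem_iota; apply/orP; right; lia.
Qed.

Lemma lpeak_no_rep i j k : k < i <= j -> ~~ repeats (lpeak j) i k.
Proof.
move=> /andP[ki ij].
have -> : repeats (lpeak j) i k = repeats (lpeak i) i k.
  rewrite -(lpeak_filter ij) /repeats -filter_predI; congr infix.
  by apply: eq_filter => c /=; lia.
case: i ki {ij} => // i ki; rewrite /repeats.
have -> : filter (pred2 i.+1 k) (lpeak i.+1)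
    = i.+1 :: rcons (filter (pred2 i.+1 k) (lpeak i)) i.+1.
  by rewrite /= eqxx filter_rcons /= eqxx.
apply: infix2_wrap.
  rewrite -has_filter; apply/hasP; exists k; last by rewrite /= eqxx orbT.
  by rewrite mem_lpeak.
by rewrite mem_filter mem_lpeak ltnn andbF.
Qed.

Lemma count0_lpeak j : count_mem 0 (lpeak j) = 1.
Proof. by elim: j => //= j IH; rewrite -cats1 count_cat IH. Qed.

Lemma count_lpeak i j : 0 < i <= j -> count_mem i (lpeak j) = 2.
Proof.
elim: j => [|j IH] hi; first lia.
rewrite /= -cats1 count_cat /=; have [->|ij] := eqVneq i j.+1.
  have /count_memPn -> : j.+1 \notin lpeak j by rewrite mem_lpeak ltnn.
  by [].
by rewrite IH //; lia.
Qed.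

Lemma infix_filter (T : eqType) (p : pred T) u v :
  infix u v -> all p u -> infix u (filter p v).
Proof.
case/infixP=> x [y ->] /all_filterP hu; rewrite !filter_cat hu.
exact: infix_infix.
Qed.

Lemma infix_rep v i j : infix [:: i; i] v -> repeats v i j.
Proof. by move=> h; apply: infix_filter => //=; rewrite eqxx. Qed.

(** A factor [i j i] makes the edge from [i] to its other neighbour [k] fail to
    alternate; this is how forbidden factors are excluded below. *)
Lemma infix_rep3 v i j k : infix [:: i; j; i] v -> i != j -> k != j -> repeats v i k.
Proof.
move=> /infixP[x [y ->]] ij kj; rewrite /repeats !filter_cat /=.
by rewrite eqxx /= [j == i]eq_sym [j == k]eq_sym (negbTE ij) (negbTE kj) infix_infix.
Qed.

Lemma lpeak_no_infix2 j i : ~~ infix [:: i; i] (lpeak j).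
Proof.
apply/negP=> h; have := mem_infix h (mem_head _ _); rewrite mem_lpeak => ij.
have [i0|i0] := posnP i.
  move/infixP: h => [x [y e]]; have := count0_lpeak j.
  by rewrite e i0 count_cat /=; lia.
by have /negP := @lpeak_no_rep i j i.-1 ltac:(lia); apply; exact: infix_rep.
Qed.

Lemma lpeak_no_infix3 j i : 1 < i -> ~~ infix [:: i; i.-1; i] (lpeak j).
Proof.
move=> i1; apply/negP=> h.
have := mem_infix h (mem_head _ _); rewrite mem_lpeak => ij.
have /negP := @lpeak_no_rep i j i.-2 ltac:(lia); apply.
by apply: infix_rep3 h _ _; lia.
Qed.

Section Family.
Variable n : nat.

Lemma rep_mirror v i j : i <= n -> j <= n -> all (leq^~ n) v ->
  repeats (mirror n v) (n - i) (n - j) = repeats v i j.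
Proof.
move=> hi hj hv.
suff W u a b : a <= n -> b <= n -> all (leq^~ n) u -> repeats u a b ->
    repeats (mirror n u) (n - a) (n - b).
  apply/idP/idP => [h|]; last exact: W.
  rewrite -(mirrorK hv) -(subKn hi) -(subKn hj); apply: W h; try exact: leq_subr.
  exact: all_mirror.
move=> ha hb hu /repeatsP[x [y [z [e ya yb]]]]; apply/repeatsP.
exists (mirror n x), (mirror n y), (mirror n z); split.
- by rewrite e /mirror !map_cat /= map_cat.
- apply: contra ya => /mapP[c cy e']; suff -> : a = c by [].
  by have := allP hu c; rewrite e !(mem_cat, inE) cy !orbT => /(_ isT); lia.
- apply: contra yb => /mapP[c cy e']; suff -> : b = c by [].
  by have := allP hu c; rewrite e !(mem_cat, inE) cy !orbT => /(_ isT); lia.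
Qed.

Definition rpeak k := mirror n (lpeak (n - k)).

Lemma mirror_right_peak v k : k <= n -> filter (leq k) v = rpeak k ->
  mirror n (filter (leq k) v) = lpeak (n - k).
Proof.
by move=> kn ->; rewrite /rpeak mirrorK //; apply: sub_all (lpeak_le _) => c /=; lia.
Qed.

Lemma count_left_peak v i j : i <= j -> filter (leq^~ j) v = lpeak j ->
  count_mem i v = count_mem i (lpeak j).
Proof.
move=> ij <-; rewrite count_filter; apply: eq_count => c /=.
by case: eqP => // ->; rewrite ij.
Qed.

Lemma count_right_peak v i k : all (leq^~ n) v -> k <= i <= n ->
  filter (leq k) v = rpeak k -> count_mem i v = count_mem (n - i) (lpeak (n - k)).
Proof.
move=> vn hi fv; rewrite -(mirror_right_peak _ fv); last lia.
rewrite /mirror [RHS]count_map count_filter; apply: eq_in_count => c /(allP vn) /=; lia.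
Qed.

(** The common form of the families (ALT), (LP), (RP) and (LRP): [j = 0] stands
    for the absence of a left peak and [k = n] for the absence of a right peak.
    *)
Record peaked (v : seq nat) (j k : nat) : Prop := BuildPeaked {
  peaked_range : j < k <= n;
  peaked_up : forall i, i < n -> repeats v i i.+1 -> 0 < i <= j;
  peaked_down : forall i, 0 < i <= n -> repeats v i i.-1 -> k <= i < n;
  peaked_left : 0 < j -> filter (leq^~ j) v = lpeak j;
  peaked_right : k < n -> filter (leq k) v = rpeak k }.

Lemma no_rep_ends v : convex_braid_free n v -> all (leq^~ n) v ->
  repeats v 0 1 = false /\ repeats v n n.-1 = false.
Proof.
move=> gv hv; split; apply/negP=> /repeatsP[x [y [z [e y0 y1]]]];
  apply: (no_repeat gv e); apply/allP=> c cy; rewrite /far /=.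
  have c0 : c != 0 by apply: contraNneq y0 => <-.
  have c1 : c != 1 by apply: contraNneq y1 => <-.
  lia.
have c0 : c != n by apply: contraNneq y0 => <-.
have c1 : c != n.-1 by apply: contraNneq y1 => <-.
by have := allP hv c; rewrite e !(mem_cat, inE) cy !orbT => /(_ isT); lia.
Qed.

Hypothesis hn : 1 < n.

(** Letters [<= i] after the peak, or before it, would make the word a zigzag by
    [half_turn]. *)
Lemma left_peak v i : convex_braid_free n v -> all (leq^~ n) v -> ~ ZZword n v -> 0 < i < n ->
  repeats v i i.+1 -> filter (leq^~ i) v = lpeak i.
Proof.
move=> gv hv nz hi /repeatsP[x [y [z [e yi yi1]]]].
have hz : filter (leq^~ i) z = [::].
  apply/filter0; rewrite all_predC; apply/negP=> h; apply: nz.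
  exact: (half_turn hn hv gv e).
have hx : filter (leq^~ i) x = [::].
  apply/filter0; rewrite all_predC; apply/negP=> h; apply: nz.
  have er : rev v = rev z ++ i :: rev y ++ i :: rev x.
    by rewrite e rev_cat rev_cons rev_cat rev_cons -!cats1 -!catA.
  have [[p ep] [l [hl cl]]] : ZZword n (rev v).
    by apply: (half_turn hn _ (convex_braid_free_rev gv) er hi); rewrite ?all_rev ?mem_rev ?has_rev.
  split; last by exists l; split=> //; rewrite -count_rev.
  have [q eq] := rev_zigrun hn p (size v); exists q.
  by rewrite -eq -[LHS]revK ep size_rev.
rewrite e filter_cat /= leqnn filter_cat /= leqnn hx hz /=.
rewrite (_ : filter _ y = lpeak i.-1); first by case: (i) hi => // i' _; rewrite cats1.
rewrite -(between_lpeak gv e hi) //; apply: eq_in_filter => c cy.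
by rewrite leq_eqVlt; case: eqP cy yi => // -> ->.
Qed.

Lemma ZZword_mirror v : all (leq^~ n) v -> ZZword n (mirror n v) -> ZZword n v.
Proof.
move=> hv [[p ep] [i [hi ci]]]; split.
  exists (p + n); rewrite -mirror_zigrun // -[LHS](mirrorK hv) ep.
  by rewrite size_map.
exists (n - i); split; first lia.
rewrite (leq_trans ci) // /mirror count_map; apply: eq_leq; apply: eq_in_count => c cv /=.
by have := allP hv _ cv; lia.
Qed.

Lemma right_peak v i : convex_braid_free n v -> all (leq^~ n) v -> ~ ZZword n v -> 0 < i < n ->
  repeats v i i.-1 -> filter (leq i) v = rpeak i.
Proof.
move=> gv hv nz hi hr.
have hl : filter (leq^~ (n - i)) (mirror n v) = lpeak (n - i).
  apply: left_peak; [exact: convex_braid_free_mirror | exact: all_mirror | | lia |].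
    by move=> /(ZZword_mirror hv).
  by have -> : (n - i).+1 = n - i.-1; [lia | rewrite rep_mirror //; lia].
rewrite /rpeak -hl -[in LHS](mirrorK hv) /mirror filter_map; congr map.
by apply: eq_in_filter => _ /mapP[c cv ->] /=; have := allP hv _ cv; lia.
Qed.

Lemma max_below (p : pred nat) N :
  exists j, (forall i, i < N -> p i -> i <= j) /\ (j = 0 \/ j < N /\ p j).
Proof.
elim: N => [|N [j [h1 h2]]]; first by exists 0; split=> //; left.
case pN : (p N).
  by exists N; split=> [i|]; [rewrite ltnS | right].
exists j; split=> [i|]; last by case: h2 => [|[h ?]]; [left | right; split=> //; lia].
by rewrite ltnS leq_eqVlt => /predU1P[-> | /h1//]; rewrite pN.
Qed.

(** Take [j] maximal with a left peak at [j], and [k] minimal with a right peak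
    at [k]. We have [j < k], since a left peak at [j] contains all the letters
    [k <= j] of the word and they alternate with [k.-1]. *)
Theorem convex_braid_free_classification v : convex_braid_free n v -> all (leq^~ n) v ->
  ZZword n v \/ exists j k,
   [/\ peaked v j k, 0 < j -> repeats v j j.+1 & k < n -> repeats v k k.-1].
Proof.
move=> gv hv; have [e0 en] := no_rep_ends gv hv.
case: (ClassicalEpsilon.excluded_middle_informative (ZZword n v)) => nz; [by left | right].
have [j [hj1 hj2]] := max_below (fun i => repeats v i i.+1) n.
have [k' [hk1 hk2]] := max_below (fun i => repeats v (n - i) (n - i).-1) n.
pose k := n - k'; exists j, k.
have hj : 0 < j -> j < n /\ repeats v j j.+1 by case: hj2 => [->|].
have hk : k < n -> 0 < k /\ repeats v k k.-1.
  by rewrite /k; case: hk2 => [->|[h1 h2] _]; [rewrite subn0 ltnn | split=> //; lia].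
have jl : 0 < j -> filter (leq^~ j) v = lpeak j.
  by move=> j0; have [jn rj] := hj j0; apply: left_peak => //; lia.
have kr : k < n -> filter (leq k) v = rpeak k.
  by move=> kn; have [k0 rk] := hk kn; apply: right_peak => //; lia.
split=> [|/hj[]//|/hk[]//]; split=> //.
- apply/andP; split; last by rewrite /k; lia.
  rewrite ltnNge; apply/negP=> kj.
  have [j0|j0] := posnP j; first by move: hk; rewrite /k in kj *; case: hk2; lia.
  have [jn rj] := hj j0; have [k0 rk] := hk (leq_ltn_trans kj jn).
  have /negP : ~~ repeats (lpeak j) k k.-1 by apply: lpeak_no_rep; lia.
  apply.
  rewrite -jl // /repeats -filter_predI; move: rk; rewrite /repeats; congr infix.
  by apply: eq_filter => c /=; lia.
- move=> i hi ri; rewrite hj1 // andbT lt0n; apply: contraTneq ri => ->.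
  by rewrite e0.
- move=> i hi ri; have ni : i < n.
    rewrite ltn_neqAle; apply/andP; split; last lia.
    by apply: contraTneq ri => ->; rewrite en.
  rewrite ni andbT /k; have := hk1 (n - i); rewrite subKn; last lia.
  by move=> /(_ _ ri); lia.
Qed.

(** The forbidden factors proper, to be excluded in each word of a commutation
    class. *)
Definition factor_braid_free v : Prop := forall a b, [/\ ~~ infix [:: a; a] v,
  nbr a b -> 0 < a < n -> 0 < b < n -> ~~ infix [:: a; b; a] v &
  nbr a b -> a <= n -> b <= n -> ~~ infix [:: a; b; a; b] v].

Lemma rpeak_infix k v u : all (leq^~ n) u -> all (leq^~ n) v -> k <= n ->
  filter (leq k) v = rpeak k -> all (leq k) u -> infix u v -> infix (mirror n u) (lpeak (n - k)).
Proof.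
move=> hu hv hk fv ku /infix_filter /(_ ku); rewrite fv => /infixP[x [y e]].
rewrite -[lpeak _](mirrorK (n := n)); last first.
  by apply: sub_all (lpeak_le (n - k)) => c /=; lia.
rewrite -/(rpeak k) e /mirror !map_cat; exact: infix_infix.
Qed.

(** A forbidden factor makes an edge fail to alternate, which puts the factor
    inside one of the two peaks; these contain no such factor. *)
Lemma peaked_factor_braid_free v j k : all (leq^~ n) v -> peaked v j k -> factor_braid_free v.
Proof.
move=> hv [/andP[jk kn] up down left right].
have vn u c : infix u v -> c \in u -> c <= n.
  by move=> /mem_infix uv /uv /(allP hv).
have upl i : repeats v i i.+1 -> i < n -> forall u, all (leq^~ i) u -> infix u v ->
    infix u (lpeak j).
  move=> ri hi u ui uv; have /andP[i0 ij] := up _ hi ri.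
  rewrite -left; last by lia.
  by apply: infix_filter => //; apply: sub_all ui => c /=; lia.
have downr i : repeats v i i.-1 -> 0 < i <= n -> forall u, all (leq i) u -> infix u v ->
    infix (mirror n u) (lpeak (n - k)).
  move=> ri hi u ui uv; have /andP[ki ni] := down _ hi ri.
  apply: (@rpeak_infix k v) => //.
  - by apply/allP=> c /(vn _ _ uv).
  - by apply: right; lia.
  - by apply: sub_all ui => c /=; lia.
have braid3 a b : nbr a b -> 0 < a < n -> 0 < b < n -> ~~ infix [:: a; b; a] v.
  move=> ab ha hb; apply/negP=> h.
  have [eb | eb] : b = a.+1 \/ b = a.-1 by move: ab; rewrite /nbr; lia.
    have ra : repeats v a a.-1 by apply: infix_rep3 h _ _; lia.
    have /negP := @lpeak_no_infix3 (n - k) (n - a) ltac:(lia); apply.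
    rewrite (_ : (n - a).-1 = n - b); last lia.
    by apply: (downr a ra _ [:: a; b; a]) => //=; lia.
  have ra : repeats v a a.+1 by apply: infix_rep3 h _ _; lia.
  have /negP := @lpeak_no_infix3 j a ltac:(lia); apply; rewrite -eb.
  by apply: (upl a ra) => //=; lia.
have fold a b u : nbr a b -> 0 < a < n -> ~~ (0 < b < n) -> b <= n ->
    infix [:: a; b; a] v -> infix u v -> all (pred2 a b) u -> count_mem b u < 2.
  move=> ab ia ib bn h hu /allP uab.
  have [b0 | bn'] : b = 0 \/ b = n by lia.
    have a1 : a = 1 by move: ab; rewrite /nbr; lia.
    have r1 : repeats v 1 2 by rewrite a1 b0 in h; apply: infix_rep3 h _ _.
    have /infixP[x [y e]] : infix u (lpeak j).
      apply: (upl 1 r1) => //; apply/allP=> c /uab /=; lia.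
    by have := count0_lpeak j; rewrite e b0 !count_cat; lia.
  have a1 : a = n.-1 by move: ab; rewrite /nbr; lia.
  have r1 : repeats v a a.-1 by apply: infix_rep3 h _ _; lia.
  have /infixP[x [y e]] : infix (mirror n u) (lpeak (n - k)).
    by apply: (downr a r1) => //; [lia | apply/allP=> c /uab /=; lia].
  have := count0_lpeak (n - k); rewrite e !count_cat.
  suff -> : count_mem 0 (mirror n u) = count_mem b u by lia.
  rewrite /mirror count_map; apply: eq_in_count => c cu /=.
  by have := vn _ _ hu cu; lia.
move=> a b; split.
- apply/negP=> h; have an : a <= n by apply: vn h _; rewrite mem_head.
  have [ean|ltan] := eqVneq a n.
    by have := down a _ (infix_rep _ h); lia.
  have /negP := lpeak_no_infix2 j a; apply.
  apply: (upl a) => //; [exact: infix_rep | lia | by rewrite /= leqnn].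
- exact: braid3.
move=> ab an bn; apply/negP=> h.
have h1 : infix [:: a; b; a] v.
  by apply: infix_trans h; rewrite -[[:: a; b; a; b]]/([:: a; b; a] ++ [:: b]) prefix_infix.
have h2 : infix [:: b; a; b] v.
  by apply: infix_trans h; rewrite infix_cons.
have [ia | ia] := boolP (0 < a < n); have [ib | ib] := boolP (0 < b < n).
- by have /negP[] := braid3 a b ab ia ib.
- by have := @fold a b [:: a; b; a; b] ab ia ib bn h1 h; rewrite /= !eqxx !orbT /= addnC; lia.
- have := @fold b a [:: a; b; a; b] _ ib ia an h2 h.
  by rewrite nbr_sym /= !eqxx !orbT /= => /(_ ab isT); lia.
- by move: ab; rewrite /nbr; lia.
Qed.

End Family.

(** * From words back to commutation classes *)

Section Bridge.
Variables (n : nat) (hn : 1 < n).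

Lemma infix_zigrun u p k : infix u (zigrun n p k) -> exists q, u = zigrun n q (size u).
Proof.
case/infixP=> x [y e].
have ek : k = size x + (size u + size y).
  by rewrite -!size_cat -e size_zigrun.
rewrite ek !zigrun_cat in e; exists (p + size x).
move/eqP: e; rewrite eqseq_cat ?size_zigrun // => /andP[_].
by rewrite eqseq_cat ?size_zigrun // => /andP[/eqP].
Qed.

Lemma infix_zigrun_nbr a b p k : infix [:: a; b] (zigrun n p k) -> nbr a b.
Proof. by move=> /infix_zigrun[q [-> ->]]; exact: zigzagS. Qed.

Lemma infix_lpeak_nbr a b j : j <= n -> infix [:: a; b] (lpeak j) -> nbr a b.
Proof. by move=> jn; rewrite (lpeak_zigrun hn jn); exact: infix_zigrun_nbr. Qed.

Lemma infix_rpeak_nbr a b k : infix [:: a; b] (rpeak n k) -> nbr a b.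
Proof.
rewrite /rpeak (lpeak_zigrun hn (leq_subr k n)) mirror_zigrun //.
exact: infix_zigrun_nbr.
Qed.

Lemma zigrun_factor_braid_free p k : factor_braid_free n (zigrun n p k).
Proof.
move=> a b; split.
- by apply/negP=> /infix_zigrun_nbr; rewrite /nbr; lia.
- move=> ab ha hb; apply/negP=> /infix_zigrun[q [ea eb ea']].
  by have := @zigzag_turn n hn q; rewrite -ea -eb -ea' => /(_ erefl); lia.
move=> ab an bn; apply/negP=> /infix_zigrun[q [ea eb ea' eb']].
have := @zigzag_turn n hn q; have := @zigzag_turn n hn q.+1.
rewrite -ea' -ea -eb -eb' => /(_ erefl) + /(_ erefl).
by move: ab; rewrite /nbr; lia.
Qed.

Definition apart a b := (a.+1 < b) || (b.+1 < a).

Lemma filter_swap (p : pred nat) x y a b : ~~ (p a && p b) ->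
  filter p (x ++ [:: a; b] ++ y) = filter p (x ++ [:: b; a] ++ y).
Proof.
by move=> h; rewrite !filter_cat; congr (_ ++ (_ ++ _)) => /=;
  case: (p a) (p b) h => -[].
Qed.

(** The swapped letters are not neighbours, hence they cannot be adjacent in a
    subword [u] all of whose consecutive letters are. *)
Lemma filter_swap_word (p : pred nat) x y a b u : apart a b ->
  (infix [:: a; b] u -> nbr a b) ->
  filter p (x ++ [:: a; b] ++ y) = u -> filter p (x ++ [:: b; a] ++ y) = u.
Proof.
move=> ab hu e; have [/andP[pa pb]|h] := boolP (p a && p b); last first.
  by rewrite -filter_swap.
have : nbr a b; last by move: ab; rewrite /nbr /apart; lia.
by apply: hu; rewrite -e !filter_cat /= pa pb infix_infix.
Qed.

Lemma peaked_swap x y a b j k : apart a b ->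
  peaked n (x ++ [:: a; b] ++ y) j k -> peaked n (x ++ [:: b; a] ++ y) j k.
Proof.
move=> ab [hr up down left right].
have rE i i' : i <= i'.+1 -> i' <= i.+1 ->
    repeats (x ++ [:: a; b] ++ y) i i' = repeats (x ++ [:: b; a] ++ y) i i'.
  move=> h1 h2; rewrite /repeats filter_swap //=.
  by move: ab; rewrite /apart; lia.
split=> //.
- by move=> i hi; rewrite -rE //; [exact: up | lia].
- by move=> i hi; rewrite -rE //; [exact: down | lia | lia].
- by move=> /left; apply: filter_swap_word => //; apply: infix_lpeak_nbr; lia.
- by move=> /right; apply: filter_swap_word => //; exact: infix_rpeak_nbr.
Qed.

Notation vals w := (map (@nat_of_ord n.+1) w).

Lemma vals_le (w : seq 'I_n.+1) : all (leq^~ n) (vals w).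
Proof. by apply/allP=> _ /mapP[c _ ->] /=; rewrite -ltnS. Qed.

Definition zigzag_or_peaked (v : seq nat) : Prop :=
  (exists p, v = zigrun n p (size v)) \/ exists j k, peaked n v j k.

(** Zigzags admit no commutation at all, and neither do the peaks. *)
Lemma zigzag_or_peaked_comm (w w' : seq 'I_n.+1) : comm_eq (@mC n) w w' ->
  zigzag_or_peaked (vals w) <-> zigzag_or_peaked (vals w').
Proof.
elim=> {w w'} // [_ _ [u v s t st] | w w' _ -> // | u v w _ -> _ -> //].
have ab : apart s t by move: st; case: (mCP hn).
suff W (a b : nat) x y : apart a b -> zigzag_or_peaked (x ++ [:: a; b] ++ y) ->
    zigzag_or_peaked (x ++ [:: b; a] ++ y).
  rewrite !map_cat /=; split; apply: W => //.
  by move: ab; rewrite /apart orbC.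
move=> {s t st u v} ab [[p e]|[j [k h]]]; last first.
  by right; exists j, k; exact: peaked_swap.
have : nbr a b; last by move: ab; rewrite /nbr /apart; lia.
apply: (@infix_zigrun_nbr a b p (size (x ++ [:: a; b] ++ y))).
by rewrite -e infix_infix.
Qed.

Lemma zigzag_or_peaked_factor_braid_free (w : seq 'I_n.+1) :
  zigzag_or_peaked (vals w) -> factor_braid_free n (vals w).
Proof.
case=> [[p ->]|[j [k h]]]; first exact: zigrun_factor_braid_free.
exact: peaked_factor_braid_free (vals_le w) h.
Qed.

Lemma zigzag_or_peaked_braid_free (w : seq 'I_n.+1) :
  zigzag_or_peaked (vals w) -> braid_free (@mC n) w.
Proof.
move=> hw v x y s t /zigzag_or_peaked_comm /iffLR /(_ hw) /zigzag_or_peaked_factor_braid_free nv.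
have sub u : v = x ++ u ++ y -> infix (vals u) (vals v).
  by move=> ->; rewrite !map_cat infix_infix.
have [h2 h3 h4] := nv s t; have hs := ltn_ord s; have ht := ltn_ord t.
split=> [/sub|]; first exact/negP.
case: (mCP hn) => // [adj is_ it | adj e] _ /sub /=; apply/negP.
  exact: h3.
by apply: h4 => //; rewrite -ltnS.
Qed.

Lemma vals_split (w : seq 'I_n.+1) x a y : vals w = x ++ a :: y ->
  exists w1 s w2, [/\ w = w1 ++ s :: w2, vals w1 = x, nat_of_ord s = a & vals w2 = y].
Proof.
elim: x w => [|c x IH] [|s w] //= [es].
  by move=> <-; exists [::], s, w.
by move=> /IH[w1 [s' [w2 [-> <- <- <-]]]]; exists (s :: w1), s', w2; rewrite /= es.
Qed.

Lemma vals_far (s : 'I_n.+1) y : all (far s) (vals y) -> all (fun t => mC s t == 2) y.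
Proof.
by rewrite all_map; apply: sub_all => t /=; rewrite /far /= orbC => h; rewrite mC_far // orbC.
Qed.

Lemma mC_nbr (s t : 'I_n.+1) : nbr s t -> 2 < mC s t.
Proof. by rewrite /nbr; case: (mCP hn) => // [-> | ]; lia. Qed.

(** The letters between the elements of a convex braid can be moved out by
    commutations, so that the braid becomes a factor. *)
Lemma braid_free_convex (w : seq 'I_n.+1) : braid_free (@mC n) w -> convex_braid_free n (vals w).
Proof.
move=> gw; pose m := @mC n.
have fwd (s : 'I_n.+1) y z : all (far s) (vals y) -> comm_eq m (s :: y ++ z) (y ++ s :: z).
  move=> /vals_far /comm_move /(comm_ctx [::] z).
  by rewrite /= cat_rcons.
have bwd (s : 'I_n.+1) y z : all (far s) (vals y) -> comm_eq m (y ++ s :: z) (s :: y ++ z).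
  by move=> h; apply: comms; exact: fwd.
have ctx x u v : comm_eq m u v -> comm_eq m (x ++ u) (x ++ v).
  by move=> h; have := comm_ctx x [::] h; rewrite !cats0.
split.
- move=> x y z a /vals_split[x' [s [w1 [e _ es /vals_split[y' [s' [z' [e' ey es' _]]]]]]]].
  rewrite -ey -es => hy; have {es'}ess : s' = s by apply: val_inj; rewrite /= es es'.
  rewrite e e' ess in gw.
  by case: (gw _ (x' ++ y') z' s s (ctx x' _ _ (fwd s y' _ hy))) => + _; apply;
    rewrite -catA.
- move=> x y1 y2 z a b /vals_split[x' [s [w1 [e _ es /vals_split[y1' [t [w2 [e1 ey1 et]]]]]]]].
  move=> /vals_split[y2' [s' [z' [e2 ey2 es' _]]]] ab ha hb.
  rewrite -ey1 -ey2 -es => h1 h2.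
  have {es'}ess : s' = s by apply: val_inj; rewrite /= es es'.
  rewrite e e1 e2 ess in gw.
  have c1 := ctx x' _ _ (fwd s y1' (t :: y2' ++ s :: z') h1).
  have c2 := ctx (x' ++ y1') _ _ (ctx [:: s; t] _ _ (bwd s y2' z' h2)).
  rewrite -!catA /= in c2.
  have [_] := gw _ (x' ++ y1') (y2' ++ z') s t (commt c1 c2).
  have -> : mC s t = 3.
    case: (mCP hn) => [/(congr1 val) /=|far|//|_]; move: ab; rewrite /nbr -es -et in ha hb *; lia.
  by apply=> //; rewrite -!catA.
move=> x y1 y2 y3 z a b /vals_split[x' [s [w1 [e _ es /vals_split[y1' [t [w2 [e1 ey1 et]]]]]]]].
move=> /vals_split[y2' [s' [w3 [e2 ey2 es' /vals_split[y3' [t' [z' [e3 ey3 et' _]]]]]]]] ab.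
rewrite -ey1 -ey2 -ey3 -es -et => h1 h2 h3 h4.
have {es'}ess : s' = s by apply: val_inj; rewrite /= es es'.
have {et'}ett : t' = t by apply: val_inj; rewrite /= et et'.
rewrite e e1 e2 e3 ess ett in gw.
have c1 := ctx x' _ _ (fwd s y1' (t :: y2' ++ s :: y3' ++ t :: z') h1).
have c2 := ctx (x' ++ y1') _ _ (ctx [:: s; t] _ _ (bwd s y2' (y3' ++ t :: z') h2)).
have c3 := ctx (x' ++ y1') _ _ (ctx [:: s; t; s] _ _ (ctx y2' _ _ (bwd t y3' z' h4))).
have c4 := ctx (x' ++ y1') _ _ (ctx [:: s; t; s] _ _ (bwd t y2' (y3' ++ z') h3)).
rewrite -!catA /= in c2 c3 c4.
have cc := commt (commt c1 c2) (commt c3 c4).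
have m2 : 2 < mC s t by apply: mC_nbr; rewrite es et.
have [m3|m4] : mC s t = 3 \/ mC s t = 4 by move: m2; case: (mCP hn); auto.
  have [_] := gw _ (x' ++ y1') (t :: y2' ++ y3' ++ z') s t cc.
  by rewrite m3; apply=> //; rewrite -!catA.
have [_] := gw _ (x' ++ y1') (y2' ++ y3' ++ z') s t cc.
by rewrite m4; apply=> //; rewrite -!catA.
Qed.

End Bridge.

(** * Linear extensions of heaps *)

Section Linearizations.
Variables (S : finType) (e : rel S) (d : Order.disp_t) (H : finPOrderType d).
Variables (lab : H -> S).
Implicit Types (x y z : H) (L : seq H) (A : {set H}) (w : seq S).

(** A listing of the heap in an order compatible with its partial order;
    distinctness of the entries follows from the second condition. *)
Definition linearization L : Prop :=
  (forall x, x \in L) /\ pairwise (fun x y => ~~ (y <= x)%O) L.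

(** Sort the elements by the number of those below them. *)
Lemma linearization_exists : exists L, linearization L.
Proof.
pose rank x := #|[set y | (y < x)%O]|.
pose L := sort (relpre rank leq) (enum H).
have rank_lt x y : (x < y)%O -> rank x < rank y.
  move=> xy; apply: proper_card; apply/properP; split.
    by apply/subsetP=> z; rewrite !inE => /lt_trans; apply.
  by exists x; rewrite !inE ?ltxx.
have uL : uniq L by rewrite sort_uniq enum_uniq.
have sL : pairwise (relpre rank leq) L.
  rewrite -sorted_pairwise; last by move=> x y z /=; exact: leq_trans.
  by apply: sort_sorted => x y; exact: leq_total.
exists L; split=> [x|]; first by rewrite mem_sort mem_enum.
rewrite uniq_pairwise in uL.
have := conj sL uL => /andP; rewrite -pairwise_relI; apply: sub_pairwise => x y /= /andP[rxy xy].
apply: contraL rxy => yx; rewrite -ltnNge; apply: rank_lt.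
by rewrite lt_neqAle eq_sym xy.
Qed.

Section WithLinearization.
Variables (L : seq H) (hL : linearization L).

Lemma linearization_uniq : uniq L.
Proof.
apply: (pairwise_uniq _ hL.2) => x; rewrite lexx //.
Qed.

Lemma linearization_cat L1 L2 x y : L = L1 ++ L2 -> x \in L1 -> y \in L2 ->
  ~~ (y <= x)%O.
Proof.
move=> eL x1 y2; have := hL.2; rewrite eL pairwise_cat => /and3P[/allrelP h _ _].
exact: h.
Qed.

Lemma filter_chain A : {in A &, forall x y, (x >=< y)%O} ->
  pairwise <=%O [seq x <- L | x \in A].
Proof.
move=> cA; have := pairwise_filter (mem A) hL.2.
apply: (@sub_in_pairwise _ (mem A)); last by apply: filter_all.
move=> x y xA yA /= yx; have := cA x y xA yA.
by rewrite /Order.comparable (negbTE yx) orbF.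
Qed.

(** A linear extension lists the elements of a chain in increasing order. *)
Lemma chain_unique A F : {in A &, forall x y, (x >=< y)%O} -> pairwise <=%O F ->
  uniq F -> F =i A -> F = [seq x <- L | x \in A].
Proof.
move=> cA pF uF FA; apply: (@pairwise_eq _ <=%O) => //.
- exact: le_anti.
- exact: filter_chain.
apply: uniq_perm => //; first by apply/filter_uniq/linearization_uniq.
by move=> x; rewrite FA mem_filter hL.1 andbT.
Qed.

Hypothesis (hH : is_heap e lab).

Lemma chain_labelsE A s s' : e s s' -> e s' s ->
  chain_labels lab A s s' =
  map lab [seq x <- L | x \in A :&: restr lab [set s; s']].
Proof.
move=> ss' s's; set B := A :&: _; congr map.
have cB : {in B &, forall x y, (x >=< y)%O}.
  move=> x y; rewrite !inE => /andP[_ hx] /andP[_ hy]; apply: hH.1.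
  by case/orP: hx => /eqP ->; case/orP: hy => /eqP ->; rewrite /eq_or_adj /= ?eqxx ?ss' ?s's ?orbT.
apply: chain_unique => //.
- rewrite -sorted_pairwise; last exact: le_trans.
  apply: (@sort_sorted_in _ (mem B)) => [x y xB yB|]; first exact: cB.
  by apply/allP=> x; rewrite mem_enum.
- by rewrite sort_uniq enum_uniq.
- by move=> x; rewrite mem_sort mem_enum.
Qed.

Let w := map lab L.
Let size_wL : size w = size L. Proof. by rewrite size_map. Qed.
Let elt (i : 'I_(size w)) : H := tnth (in_tuple L) (cast_ord size_wL i).

Lemma nth_elt x0 (i : 'I_(size w)) : elt i = nth x0 L i.
Proof. by rewrite /elt (tnth_nth x0). Qed.

Lemma lab_elt i : lab (elt i) = tnth (in_tuple w) i.
Proof.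
by rewrite (tnth_nth (lab (elt i))) /= /w (nth_map (elt i)) -?size_wL // -nth_elt.
Qed.

Lemma elt_inj : injective elt.
Proof.
move=> i j; rewrite (nth_elt (elt i)) (nth_elt (elt i) j) => /eqP.
by rewrite nth_uniq -?size_wL // ?linearization_uniq // => /eqP/val_inj.
Qed.

Lemma elt_surj x : exists i, elt i = x.
Proof.
have xL := hL.1 x; have ix : index x L < size w by rewrite size_wL index_mem.
by exists (Ordinal ix); rewrite (nth_elt x) /= nth_index.
Qed.

Lemma elt_lt i j : (elt i < elt j)%O -> i < j.
Proof.
move=> ij; rewrite ltnNge leq_eqVlt; apply/negP=> /orP[/eqP/val_inj ji|ji].
  by rewrite ji ltxx in ij.
have := hL.2 => /(pairwiseP (elt i)) /(_ j i).
rewrite !inE -size_wL !ltn_ord => /(_ isT isT ji).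
by rewrite -!nth_elt (ltW ij).
Qed.

Lemma elt_le (i j : 'I_(size w)) : i <= j -> eq_or_adj e (lab (elt i)) (lab (elt j)) ->
  (elt i <= elt j)%O.
Proof.
move=> ij /hH.1; rewrite /Order.comparable => /orP[//|].
rewrite le_eqVlt => /orP[/eqP ->|]; first exact: lexx.
by move/elt_lt; rewrite ltnNge ij.
Qed.

(** Elements with equal or adjacent labels are comparable, and their order is
    read on the positions; these relations generate the order of a heap. *)
Lemma linearization_iso : iso_Heap e lab [set: H] w.
Proof.
exists elt; split=> [||i|i j]; [exact: elt_inj | | exact: lab_elt |].
  apply/setP=> x; rewrite inE; have [i <-] := elt_surj x.
  by rewrite imset_f ?inE.
apply/idP/idP => [|/connectP[p]].
  rewrite hH.2 => /connectP[p].
  elim: p i => /= [i _ /elt_inj ->|x p IH i]; first exact: connect0.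
  have [k <-] := elt_surj x => /andP[/andP[ik eik] /IH h] /h {h} kj.
  apply: connect_trans kj; have [->|nik] := eqVneq i k; first exact: connect0.
  apply: connect1; rewrite /= -!lab_elt eik andbT; apply: elt_lt.
  by rewrite lt_neqAle ik andbT (inj_eq elt_inj).
elim: p i => /= [i _ ->|k p IH i]; first exact: lexx.
move=> /andP[/andP[ik eik] /IH h] /h; apply: le_trans.
by apply: elt_le; [exact: ltnW | rewrite !lab_elt].
Qed.

End WithLinearization.

Lemma word_le_leq w i j : word_le e (w := w) i j -> i <= j.
Proof.
case/connectP=> p; elim: p i => /= [i _ -> //|k p IH i].
by move=> /andP[/andP[ik _] /IH h] /h; apply: leq_trans; exact: ltnW.
Qed.

Lemma iso_linearization w : iso_Heap e lab [set: H] w ->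
  exists2 L, linearization L & map lab L = w.
Proof.
move=> [f [inj_f im_f lab_f le_f]]; exists (map f (enum 'I_(size w))).
  split=> [x|].
    have : x \in f @: setT by rewrite im_f.
    by case/imsetP=> i _ ->; apply: map_f; rewrite mem_enum.
  rewrite pairwise_map.
  have : pairwise (relpre val ltn) (enum 'I_(size w)).
    by rewrite -pairwise_map val_enum_ord -sorted_pairwise ?iota_ltn_sorted //; exact: ltn_trans.
  by apply: sub_pairwise => i j /= ij; rewrite le_f; apply/negP=> /word_le_leq; rewrite leqNgt ij.
rewrite -map_comp -[RHS](map_tnth_enum (in_tuple w)); exact: eq_map.
Qed.

Lemma word_le_chain w i j : sorted (eq_or_adj e) w -> word_le e (w := w) i j = (i <= j).
Proof.
move=> sw; apply/idP/idP; first exact: word_le_leq.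
move: {-2}(j - i)%N (erefl (j - i)%N) => k; elim: k j => [|k IH] j ek ij.
  have -> : i = j by apply: val_inj => /=; lia.
  exact: connect0.
have hj : j.-1 < size w by have := ltn_ord j; lia.
pose j' := Ordinal hj; have jS : j = j'.+1 :> nat by rewrite /=; lia.
apply: (@connect_trans _ _ j'); first by apply: IH => /=; lia.
apply: connect1 => /=; apply/andP; split; first by lia.
pose s0 := tnth (in_tuple w) i; rewrite !(tnth_nth s0) jS /=.
by apply: (sortedP s0 sw); rewrite -jS.
Qed.

(** When consecutive letters of [w] are equal or adjacent, [Heap(w)] is a chain.
    Such a chain is a subposet of [H] exactly when it is a subword of the linear
    extension, whatever relations pass through elements outside of it. *)
Lemma chain_isoP L (I : {set S}) w : linearization L -> is_heap e lab ->
  sorted (eq_or_adj e) w ->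
  iso_Heap e lab (restr lab I) w <-> [seq s <- map lab L | s \in I] = w.
Proof.
move=> hL hH sw; rewrite filter_map.
have -> : [seq x <- L | preim lab (mem I) x] = [seq x <- L | x \in restr lab I].
  by apply: eq_filter => x; rewrite !inE.
set F := filter _ L; have uF : uniq F by apply/filter_uniq/(linearization_uniq hL).
split=> [[f [inj_f im_f lab_f le_f]]|ew].
  have cI : {in restr lab I &, forall x y, (x >=< y)%O}.
    move=> x y; rewrite -im_f => /imsetP[i _ ->] /imsetP[j _ ->].
    by rewrite /Order.comparable !le_f !word_le_chain // leq_total.
  suff <- : map f (enum 'I_(size w)) = F.
    by rewrite -map_comp -[RHS](map_tnth_enum (in_tuple w)); exact: eq_map.
  apply: (chain_unique hL) => //.
  - rewrite pairwise_map.
    have : pairwise (relpre val ltn) (enum 'I_(size w)).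
      by rewrite -pairwise_map val_enum_ord -sorted_pairwise ?iota_ltn_sorted //; exact: ltn_trans.
    by apply: sub_pairwise => i j /= ij; rewrite le_f word_le_chain // ltnW.
  - by rewrite map_inj_uniq // enum_uniq.
  - move=> x; rewrite -im_f; apply/mapP/imsetP => -[i _ ->]; exists i => //.
    by rewrite mem_enum.
have szF : size w = size F by rewrite -ew size_map.
pose f (i : 'I_(size w)) := tnth (in_tuple F) (cast_ord szF i).
have fE x0 i : f i = nth x0 F i by rewrite /f (tnth_nth x0).
have labf i : lab (f i) = tnth (in_tuple w) i.
  have nw s0 x0 k : k < size F -> nth s0 w k = lab (nth x0 F k).
    by move=> hk; rewrite -ew (nth_map x0).
  by rewrite (tnth_nth (lab (f i))) /= (nw _ (f i)) -?szF // -fE.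
have sF : pairwise <=%O F.
  rewrite -sorted_pairwise; last exact: le_trans.
  have [/size0nil -> //|F_gt0] := posnP (size F).
  pose x0 := tnth (in_tuple F) (Ordinal F_gt0).
  apply/(sortedP x0) => i hi.
  have : (nth x0 F i >=< nth x0 F i.+1)%O.
    apply: hH.1; have := sortedP (lab x0) sw i; rewrite szF => /(_ hi).
    by rewrite -ew !(nth_map x0) //; exact: ltnW.
  rewrite /Order.comparable => /orP[//|].
  have /(pairwiseP x0) /(_ i i.+1) := pairwise_filter (mem (restr lab I)) hL.2.
  rewrite -/F !inE hi (ltnW hi) ltnSn => /(_ isT isT isT) /negbTE.
  by rewrite -/F => ->.
exists f; split=> // [i j||i j].
- rewrite (fE (f i)) (fE (f i) j) => /eqP.
  by rewrite nth_uniq -?szF // => /eqP/val_inj.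
- apply/setP=> x; apply/imsetP/idP => [[i _ ->]|xI].
    have : f i \in F by rewrite (fE (f i)) mem_nth // -szF.
    by rewrite mem_filter => /andP[].
  have xF : x \in F by rewrite mem_filter xI hL.1.
  have ix : index x F < size w by rewrite szF index_mem.
  by exists (Ordinal ix); rewrite ?inE // (fE x) /= nth_index.
rewrite word_le_chain //; have [ij|ji] := leqP i j.
  move: ij; rewrite leq_eqVlt => /orP[/eqP/val_inj ->|ij]; first exact: lexx.
  rewrite (fE (f i)) (fE (f i) j).
  by move/(pairwiseP (f i)): sF => /(_ i j); rewrite !inE -szF !ltn_ord; apply.
have /(pairwiseP (f i)) /(_ j i) := pairwise_filter (mem (restr lab I)) hL.2.
rewrite -/F !inE -szF !ltn_ord => /(_ isT isT ji).
by rewrite -!fE => /negbTE.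
Qed.

End Linearizations.

(** * The five families read on a linear extension *)

Section Transfer.
Variables (n : nat) (hn : 1 < n) (d : Order.disp_t) (H : finPOrderType d).
Variables (lab : H -> 'I_n.+1) (hH : is_heap (@graphC n) lab).
Variables (L : seq H) (hL : linearization L).
Implicit Types (x y z : H) (A : {set H}).

Notation vals w := (map (@nat_of_ord n.+1) w).

Definition read (F : seq H) : seq nat := [seq nat_of_ord (lab x) | x <- F].

Let v := read L.
Let readA A := read [seq x <- L | x \in A].

Lemma readE F : read F = vals (map lab F).
Proof. by rewrite /read -map_comp. Qed.

Lemma read_cat F G : read (F ++ G) = read F ++ read G.
Proof. exact: map_cat. Qed.

Lemma read_split F s a t : read F = s ++ a :: t ->
  exists F1 x F2, [/\ F = F1 ++ x :: F2, read F1 = s, lab x = a :> nat & read F2 = t].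
Proof.
elim: s F => [|c s IH] [|x F] //= [ex].
  by move=> <-; exists [::], x, F.
by move=> /IH[F1 [y [F2 [-> <- <- <-]]]]; exists (x :: F1), y, F2; rewrite /= ex.
Qed.

Lemma read_rep F i j : repeats (read F) i j -> exists F1 x F2 y F3,
  [/\ F = F1 ++ x :: F2 ++ y :: F3, lab x = i :> nat, lab y = i :> nat,
      i \notin read F2 & j \notin read F2].
Proof.
case/repeatsP=> s [t [u [/read_split[F1 [x [G [-> _ hx]]]]]]].
move=> /read_split[F2 [y [F3 [-> <- hy _]]]] hi hj.
by exists F1, x, F2, y, F3.
Qed.

Lemma graphC_nbr (s t : 'I_n.+1) : graphC s t = nbr s t.
Proof.
rewrite /graphC /cox_graph /= /nbr; case: (mCP hn) => [->|far|adj _ _|adj _].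
- by rewrite eqxx; lia.
- by rewrite andbF; lia.
- by rewrite -(inj_eq val_inj) /=; lia.
- by rewrite -(inj_eq val_inj) /=; lia.
Qed.

Lemma zigrun_sorted p k : sorted nbr (zigrun n p k).
Proof.
apply/(sortedP 0) => i; rewrite size_zigrun => hi.
have nthE j : j < k -> nth 0 (zigrun n p k) j = zigzag n (p + j).
  by move=> jk; rewrite (nth_map 0) ?size_iota // nth_iota.
by rewrite !nthE ?addnS; [exact: zigzagS | exact: hi | exact: ltnW].
Qed.

Lemma chain_word (w : seq 'I_n.+1) p k : vals w = zigrun n p k ->
  sorted (eq_or_adj (@graphC n)) w.
Proof.
move=> ew; have : sorted (relpre (@nat_of_ord n.+1) nbr) w.
  by rewrite -sorted_map ew zigrun_sorted.
by apply: sub_sorted => s t /=; rewrite /eq_or_adj /= graphC_nbr => ->; rewrite orbT.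
Qed.

Lemma vals_word (l : seq nat) : all (leq^~ n) l -> vals (word n l) = l.
Proof.
move=> /allP h; rewrite /word -map_comp -[RHS]map_id; apply/eq_in_map => c /h /= cn.
by rewrite inordK.
Qed.

Lemma vals_peak_left (j : 'I_n.+1) : 0 < j -> vals (peak_left n j) = lpeak j.
Proof.
move=> j0; have := ltn_ord j; rewrite ltnS => jn.
rewrite lpeakE; apply: vals_word; rewrite all_cat /= all_rev.
by apply/andP; split; apply/allP=> c; rewrite mem_iota; lia.
Qed.

Lemma vals_peak_right (k : 'I_n.+1) : k < n -> vals (peak_right n k) = rpeak n k.
Proof.
move=> kn; rewrite vals_word; last first.
  rewrite all_cat /= all_rev leqnn /=.
  by apply/andP; split; apply/allP=> c; rewrite mem_iota; lia.
have h : mirror n (iota 1 (n - k)) = rev (iota k (n - k)).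
  apply: (@eq_from_nth _ 0); first by rewrite size_map size_rev !size_iota.
  move=> i; rewrite size_map size_iota => hi.
  by rewrite nth_rev ?size_iota // (nth_map 0) ?size_iota // !nth_iota //; lia.
rewrite /rpeak lpeakE /mirror map_cat map_rev -/(mirror n (iota 1 (n - k))) h revK /=.
by rewrite subn0 -/(mirror n (iota 1 (n - k))) h.
Qed.

Lemma vals_inj : injective (map (@nat_of_ord n.+1)).
Proof. exact/inj_map/val_inj. Qed.

Lemma filter_read (I : {set 'I_n.+1}) (p : pred nat) : (forall s, (s \in I) = p s) ->
  vals [seq s <- map lab L | s \in I] = filter p v.
Proof.
move=> hI; rewrite /v readE [in RHS]filter_map; congr map.
by apply: eq_filter => s; rewrite hI.
Qed.

Lemma LP1P (j : 'I_n.+1) : 0 < j -> LP1 lab j <-> filter (leq^~ j) v = lpeak j.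
Proof.
move=> j0; have jn : j <= n by rewrite -ltnS.
rewrite -vals_peak_left // -(@filter_read (labels_from_to n 0 j)); last first.
  by move=> s; rewrite inE.
have ch := chain_word (etrans (vals_peak_left j0) (lpeak_zigrun hn jn)).
rewrite /LP1 (chain_isoP _ hL hH ch); split=> [-> //|]; exact: vals_inj.
Qed.

Lemma RP1P (k : 'I_n.+1) : k < n -> RP1 lab k <-> filter (leq k) v = rpeak n k.
Proof.
move=> kn; rewrite -vals_peak_right // -(@filter_read (labels_from_to n k n)); last first.
  by move=> s; rewrite inE -[s <= n]ltnS ltn_ord andbT.
have ch : sorted (eq_or_adj (@graphC n)) (peak_right n k).
  have e := vals_peak_right kn; rewrite /rpeak in e.
  rewrite (lpeak_zigrun hn (leq_subr k n)) mirror_zigrun // in e.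
  exact: chain_word e.
rewrite /RP1 (chain_isoP _ hL hH ch); split=> [-> //|]; exact: vals_inj.
Qed.

Lemma sorted_neqP (T : eqType) (s : seq T) :
  sorted (fun a b => a != b) s <-> forall c, ~~ infix [:: c; c] s.
Proof.
split=> [h c|h].
  apply/negP=> /infixP[x [y e]]; move: h; rewrite e.
  by move=> /cat_sorted2[_ /=]; rewrite eqxx.
case: s h => // a s; elim: s a => //= b s IH a h.
apply/andP; split; last first.
  by apply: IH => c; apply: contra (h c) => /=; rewrite orbC => ->; rewrite !orbT.
by apply/eqP=> e; have := h a; rewrite e !eqxx prefix0s.
Qed.

Lemma filter_pred2_read A (s s' : 'I_n.+1) :
  filter (pred2 (s : nat) s') (readA A)
  = vals (map lab [seq x <- L | x \in A :&: restr lab [set s; s']]).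
Proof.
rewrite /readA readE !filter_map -!filter_predI; congr (map _ (map _ _)).
by apply: eq_filter => x; rewrite !inE /= andbC -!(inj_eq val_inj).
Qed.

Lemma infix_vals (u w : seq 'I_n.+1) : infix (vals u) (vals w) = infix u w.
Proof.
apply/infixP/infixP => -[x [y]]; last first.
  by move=> ->; exists (vals x), (vals y); rewrite !map_cat.
move=> e; exists (take (size x) w), (drop (size x + size u) w).
have eu : u = take (size u) (drop (size x) w).
  apply: vals_inj; rewrite map_take map_drop e drop_size_cat //.
  by rewrite take_size_cat // size_map.
rewrite addnC -drop_drop.
have -> : u ++ drop (size u) (drop (size x) w) = drop (size x) w.
  by rewrite {1}eu cat_take_drop.
by rewrite cat_take_drop.
Qed.

Lemma alternatingP (I : {set 'I_n.+1}) A : alternating (@graphC n) lab I A <->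
  forall s s' : 'I_n.+1, s \in I -> s' \in I -> nbr s s' -> ~~ repeats (readA A) s s'.
Proof.
have chE (s s' : 'I_n.+1) : nbr s s' -> chain_labels lab A s s' =
    map lab [seq x <- L | x \in A :&: restr lab [set s; s']].
  by move=> ss'; rewrite (chain_labelsE hL hH) ?graphC_nbr // nbr_sym.
have repE (s s' : 'I_n.+1) : repeats (readA A) s s' =
    infix [:: s; s] (map lab [seq x <- L | x \in A :&: restr lab [set s; s']]).
  by rewrite /repeats filter_pred2_read -infix_vals.
split=> h s s' sI s'I.
  move=> ss'; have := h s s' sI s'I; rewrite graphC_nbr => /(_ ss').
  by rewrite chE // repE => /sorted_neqP.
rewrite graphC_nbr => ss'; rewrite chE //; apply/sorted_neqP => c.
apply/negP=> hc; have : c \in [set s; s'].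
  have /mapP[x + ->] := mem_infix hc (mem_head _ _).
  by rewrite mem_filter !inE => /andP[/andP[]].
rewrite !inE => /orP[] /eqP ec; rewrite {c}ec in hc.
  by have /negP := h s s' sI s'I ss'; rewrite repE.
have := h s' s s'I sI; rewrite nbr_sym => /(_ ss') /negP.
by rewrite repE setUC.
Qed.

(** Two consecutive [s] stay consecutive when elements with other labels are
    deleted. *)
Lemma rep_restrict A (s : 'I_n.+1) i : (forall z, lab z = s -> z \in A) ->
  repeats v s i -> repeats (readA A) s i.
Proof.
move=> hA /read_rep[F1 [x [F2 [y [F3 [eL hx hy si s'i]]]]]]; apply/repeatsP.
have xA : x \in A by apply/hA/val_inj.
have yA : y \in A by apply/hA/val_inj.
have sub F : {subset read [seq z <- F | z \in A] <= read F}.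
  by move=> c /mapP[z]; rewrite mem_filter => /andP[_ zF] ->; exact: map_f.
exists (read [seq z <- F1 | z \in A]), (read [seq z <- F2 | z \in A]),
  (read [seq z <- F3 | z \in A]); split; try by apply: contra (sub _ _) _.
  by rewrite /readA eL filter_cat /= xA filter_cat /= yA /read map_cat /= map_cat /= hx hy.
Qed.

Lemma rep_count (u : seq nat) i j : repeats u i j -> 1 < count_mem i u.
Proof.
move=> /repeatsP[x [y [z [-> _ _]]]].
by rewrite count_cat /= count_cat /= eqxx; lia.
Qed.

(** It is enough to control the edges between [j] and [k]: on the left of [j]
    and on the right of [k] the word is a peak, whose repetitions are known. *)
Lemma peaked_intro j k : j < k <= n -> (0 < j -> filter (leq^~ j) v = lpeak j) ->
  (k < n -> filter (leq k) v = rpeak n k) ->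
  (forall i i', j <= i <= k -> j <= i' <= k -> nbr i i' -> (0 < j -> i != j) ->
     (k < n -> i != k) -> ~~ repeats v i i') ->
  peaked n v j k.
Proof.
move=> hjk left right mid.
have vn : all (leq^~ n) v by rewrite /v readE; exact: vals_le.
have lrep i i' : i' < i <= j -> ~~ repeats v i i'.
  move=> hi; apply: contra (lpeak_no_rep hi); rewrite -left; last lia.
  by rewrite /repeats -filter_predI; congr infix; apply: eq_filter => c /=; lia.
have rrep i i' : k <= i < i' -> i' <= n -> k < n -> ~~ repeats v i i'.
  move=> hi hi' kn; have h : n - i' < n - i <= n - k by lia.
  apply: contra (lpeak_no_rep h).
  rewrite -(mirror_right_peak _ (right kn)); last lia.
  rewrite rep_mirror //; try lia; last first.
    by apply/allP=> c; rewrite mem_filter => /andP[_ /(allP vn)].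
  by rewrite /repeats -filter_predI; congr infix; apply: eq_filter => c /=; lia.
have c0 : 0 < j -> count_mem 0 v = 1.
  by move=> j0; rewrite (count_left_peak _ (left j0)) // count0_lpeak.
have cn : k < n -> count_mem n v = 1.
  by move=> kn; rewrite (count_right_peak vn _ (right kn)) ?subnn ?count0_lpeak //; lia.
split=> //.
- move=> i hi ri; have [i0|i0] := posnP i.
    rewrite i0 in hi ri *; have [j0|j0] := posnP j.
      by have /negP := mid 0 1 ltac:(lia) ltac:(lia) isT ltac:(lia) ltac:(lia).
    by have := rep_count ri; rewrite c0.
  rewrite /= leqNgt; apply/negP=> ji; have [ki|ik] := leqP k i.
    by have /negP := rrep i i.+1 ltac:(lia) hi ltac:(lia).
  have ab : nbr i i.+1 by rewrite /nbr eqxx.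
  by have /negP := mid i i.+1 ltac:(lia) ltac:(lia) ab ltac:(lia) ltac:(lia).
- move=> i hi ri; have [ein|ni] := eqVneq i n.
    rewrite ein in hi ri *; have [kn|nk] := ltnP k n.
      by have := rep_count ri; rewrite cn.
    have ab : nbr n n.-1 by rewrite /nbr; lia.
    by have /negP := mid n n.-1 ltac:(lia) ltac:(lia) ab ltac:(lia) ltac:(lia).
  suff : k <= i by lia.
  rewrite leqNgt; apply/negP=> ik; have [ij|ji] := leqP i j.
    by have /negP := lrep i i.-1 ltac:(lia).
  have ab : nbr i i.-1 by rewrite /nbr; lia.
  by have /negP := mid i i.-1 ltac:(lia) ltac:(lia) ab ltac:(lia) ltac:(lia).
Qed.

Lemma alternating_no_rep (j k : nat) A (P : pred nat) : k <= n ->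
  alternating (@graphC n) lab (labels_from_to n j k) A ->
  (forall z, j <= lab z <= k -> P (lab z) -> z \in A) ->
  forall i i', j <= i <= k -> j <= i' <= k -> nbr i i' -> P i -> ~~ repeats v i i'.
Proof.
move=> kn /alternatingP alt hA i i' hi hi' ab Pi.
have ei : nat_of_ord (@inord n i) = i by rewrite inordK; lia.
have ei' : nat_of_ord (@inord n i') = i' by rewrite inordK; lia.
have := alt (inord i) (inord i'); rewrite !inE ei ei' hi hi' ab => /(_ isT isT isT).
apply: contra => ri; rewrite -{1}ei; apply: rep_restrict; rewrite ?ei //.
by move=> z ez; apply: hA; rewrite ez ei.
Qed.

(** A deleted element carries the label [j] or [k], so that it does not affect
    two consecutive letters with another label. *)
Lemma families_peaked : ALT lab \/ LP lab \/ RP lab \/ LRP lab ->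
  exists j k, peaked n v j k.
Proof.
have full : [set: 'I_n.+1] = labels_from_to n 0 n.
  by apply/setP=> s; rewrite !inE /= -[s <= n]ltnS ltn_ord.
case=> [alt|[[j [hj lp1 _ [x ex alt]]]|[[k [hk rp1 _ [x ex alt]]]|]]].
- rewrite /ALT full in alt.
  exists 0, n; apply: peaked_intro => // [||i i' hi hi' ab _ _]; try (rewrite ?ltnn //; lia).
  by apply: (alternating_no_rep (P := predT) _ alt) => // z _ _; rewrite inE.
- have j0 : 0 < j by lia.
  have left := iffLR (LP1P j0) lp1.
  exists j, n; apply: peaked_intro => // [||i i' hi hi' ab ij _]; try (rewrite ?ltnn //; lia).
  apply: (alternating_no_rep (P := predC1 (j : nat)) _ alt) => //=; last by apply: ij; lia.
  move=> z hz zj; rewrite !inE hz andbT; apply: contraNneq zj => ->.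
  by rewrite ex.
- have kn : k < n by lia.
  have right := iffLR (RP1P kn) rp1.
  exists 0, k; apply: peaked_intro => // [|i i' hi hi' ab _ ik]; try (rewrite ?ltnn //; lia).
  apply: (alternating_no_rep (P := predC1 (k : nat)) _ alt) => //=; last by apply: ik; lia.
    lia.
  move=> z hz zj; rewrite !inE /= hz andbT; apply: contraNneq zj => ->.
  by rewrite ex.
move=> [j [k [[j0 jk kn] [lp1 _] [rp1 _] [x [y [ex ey alt]]]]]].
have left := iffLR (LP1P j0) lp1.
have right := iffLR (RP1P kn) rp1.
exists j, k; apply: peaked_intro => // [|i i' hi hi' ab ij ik]; first lia.
apply: (alternating_no_rep (P := predI (predC1 (j : nat)) (predC1 (k : nat))) _ alt) => //=.
- lia.
- move=> z hz /andP[zj zk]; rewrite !inE hz andbT; apply/andP; split.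
    by apply: contraNneq zk => ->; rewrite ey.
  by apply: contraNneq zj => ->; rewrite ex.
- by rewrite ij ?ik.
Qed.

(** [x] is the element whose deletion restores alternation on the edge [c, c'].
    *)
Definition splits (c c' : nat) x : Prop := exists L1 L2 y L3,
  [/\ L = L1 ++ x :: L2 ++ y :: L3, lab x = c :> nat, lab y = c :> nat,
      c \notin read L2 & c' \notin read L2].

Lemma rep_splits c c' : repeats v c c' -> exists x, splits c c' x.
Proof. by case/read_rep=> F1 [x [F2 [y [F3 h]]]]; exists x, F1, F2, y, F3. Qed.

(** The two consecutive letters [c] of [splits] reduce to one when [x] is
    deleted, so that the deletion cannot bring two letters [c'] together. *)
Lemma rep_delete A c c' x : splits c c' x -> c != c' ->
  (forall z, lab z = c :> nat -> (z \in A) = (z != x)) ->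
  (forall z, lab z = c' :> nat -> z \in A) ->
  repeats (readA A) c' c -> repeats v c' c.
Proof.
move=> [L1 [L2 [y [L3 [eL hx hy cL2 c'L2]]]]] cc' hc hc'.
have uL := linearization_uniq hL; rewrite eL in uL.
have xL1 : x \notin L1.
  by move: uL; rewrite cat_uniq /= => /and3P[_]; rewrite negb_or => /andP[].
have [xL3 yx] : x \notin L3 /\ y != x.
  move: uL; rewrite cat_uniq /= => /and3P[_ _ /andP[]].
  by rewrite mem_cat inE !negb_or eq_sym => /and3P[_ -> ->].
have part F : x \notin F ->
    filter (pred2 c' c) (read [seq z <- F | z \in A]) = filter (pred2 c' c) (read F).
  move=> xF; rewrite /read !filter_map -filter_predI; congr map.
  apply: eq_in_filter => z zF /=.
  have zx : z != x by apply: contraNneq xF => <-.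
  case: eqP => [/hc' -> //|_] /=; case: eqP => //= /hc ->; exact: zx.
have part2 : filter (pred2 c' c) (read L2) = [::].
  apply/filter0/allP=> b bL2 /=; rewrite negb_or.
  by apply/andP; split; [apply: contraNneq c'L2 | apply: contraNneq cL2] => <-.
have xL2 : x \notin L2 by apply: contra cL2 => /(map_f (fun z => nat_of_ord (lab z))); rewrite hx.
have xA : (x \in A) = false by rewrite hc // eqxx.
have yA : y \in A by rewrite hc.
rewrite /repeats {1}/readA /v eL filter_cat /= xA filter_cat /= yA.
rewrite !read_cat /= !filter_cat /= read_cat /= !filter_cat /= hx hy eqxx orbT.
rewrite !part // part2 /=.
set f1 := filter _ (read L1); set f3 := filter _ (read L3).
elim: f1 => [|b f IH]; first by move=> h; exact: infix_trans h (infix_cons _ _).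
rewrite !cat_cons ![infix _ (b :: _)]/= => /orP[/andP[eb h]|/IH ->]; rewrite ?orbT //.
by rewrite eb /=; case: f h {IH} => [|b' f] /=; rewrite !prefix0s => ->.
Qed.

(** If there are only two elements labelled [c], they are the two of [splits].
    *)
Lemma splits_not_between c c' x0 : splits c c' x0 -> count_mem c v = 2 ->
  forall x y z, lab x = c :> nat -> lab y = c :> nat -> lab z = c' :> nat ->
  ~ (x < z < y)%O.
Proof.
move=> [L1 [L2 [y0 [L3 [eL hx0 hy0 cL2 c'L2]]]]] cnt x y z hx hy hz /andP[xz zy].
have lt_before F1 F2 a b : L = F1 ++ F2 -> a \in F2 -> b \in F1 -> ~~ (a <= b)%O.
  by move=> e aF bF; apply: (linearization_cat hL e).
have cnt0 : count_mem c (read L1) = 0 /\ count_mem c (read L3) = 0.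
  move: cnt; rewrite /v eL !read_cat /= read_cat /= !count_cat /= !count_cat /= hx0 hy0 eqxx.
  by lia.
have lab_in a F : lab a = c :> nat -> count_mem c (read F) = 0 -> a \notin F.
  move=> ha /count_memPn; apply: contra => /(map_f (fun z => nat_of_ord (lab z))).
  by rewrite ha.
have two a : lab a = c :> nat -> a = x0 \/ a = y0.
  move=> ha; have := hL.1 a; rewrite eL !(mem_cat, inE).
  rewrite (negbTE (lab_in _ _ ha cnt0.1)) (negbTE (lab_in _ _ ha cnt0.2)) orbF /=.
  case/orP=> [/eqP|]; first by left.
  case/orP=> [aL2|/eqP]; last by right.
  by case/negP: cL2; rewrite -ha; exact: map_f.
have xy := lt_trans xz zy.
have [ex ey] : x = x0 /\ y = y0.
  case: (two x hx) (two y hy) => -> [] -> in xy *.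
  - by rewrite ltxx in xy.
  - by [].
  - have : ~~ (y0 <= x0)%O.
      apply: (@lt_before (L1 ++ x0 :: L2) (y0 :: L3)); rewrite ?mem_head //.
        by rewrite eL -catA.
      by rewrite mem_cat mem_head orbT.
    by rewrite ltW.
  - by rewrite ltxx in xy.
have := hL.1 z; rewrite eL mem_cat => /orP[zL1|].
  have := @lt_before L1 (x0 :: L2 ++ y0 :: L3) x0 z eL (mem_head _ _) zL1.
  by rewrite -ex ltW.
rewrite inE => /orP[/eqP ez|].
  by move: xz; rewrite ez ex ltxx.
rewrite mem_cat => /orP[zL2|zL3].
  by case/negP: c'L2; rewrite -hz; exact: map_f.
have [ez|zy0] := eqVneq z y0; first by move: zy; rewrite ez ey ltxx.
have : ~~ (z <= y0)%O; last by rewrite -ey ltW.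
apply: (@lt_before (L1 ++ x0 :: L2 ++ [:: y0]) L3).
- by rewrite eL -!catA /= -catA.
- by move: zL3; rewrite inE (negbTE zy0).
- by rewrite !(mem_cat, inE) eqxx !orbT.
Qed.

Lemma count_delete A c x : lab x = c :> nat ->
  (forall z, lab z = c :> nat -> (z \in A) = (z != x)) ->
  (count_mem c (readA A)).+1 = count_mem c v.
Proof.
move=> hx hA; have uL := linearization_uniq hL.
have := count_predC (pred1 x) [seq z <- L | lab z == c :> nat].
rewrite size_filter count_uniq_mem ?filter_uniq // mem_filter hx eqxx hL.1 add1n.
rewrite /v /readA /read !count_map -!size_filter -!filter_predI => e.
apply: etrans _ e; congr (size _).+1; apply: eq_filter => z /=.
by case: eqP => [/hA ->|]; rewrite ?andbT ?andbF //.
Qed.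

(** Each of the labels [j] and [k], when it carries a peak, occurs exactly twice
    in the word, hence once after the deletion. *)
Lemma peaked_alternating j k A : peaked n v j k ->
  (forall z, j <= lab z <= k -> (0 < j -> lab z != j :> nat) ->
     (k < n -> lab z != k :> nat) -> z \in A) ->
  (0 < j -> exists2 x, splits j j.+1 x &
     forall z, lab z = j :> nat -> (z \in A) = (z != x)) ->
  (k < n -> exists2 y, splits k k.-1 y &
     forall z, lab z = k :> nat -> (z \in A) = (z != y)) ->
  alternating (@graphC n) lab (labels_from_to n j k) A.
Proof.
move=> [hjk up down left right] hA hj hk; apply/alternatingP => s s'.
rewrite !inE => sI s'I ab; apply/negP=> ras.
have hs := ltn_ord s; have hs' := ltn_ord s'.
have vn : all (leq^~ n) v by rewrite /v readE; exact: vals_le.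
have cntj : 0 < j -> count_mem j v = 2.
  by move=> j0; rewrite (count_left_peak _ (left j0)) // count_lpeak // j0 leqnn.
have cntk : k < n -> count_mem k v = 2.
  by move=> kn; rewrite (count_right_peak vn _ (right kn)) ?count_lpeak //; lia.
have nj : (s : nat) = j -> 0 < j -> False.
  move=> es j0; have [x [L1 [L2 [y [L3 [_ hx _ _ _]]]]] hx'] := hj j0.
  by have := rep_count ras; have := count_delete hx hx'; rewrite es cntj //; lia.
have nk : (s : nat) = k -> k < n -> False.
  move=> es kn; have [x [L1 [L2 [y [L3 [_ hx _ _ _]]]]] hx'] := hk kn.
  by have := rep_count ras; have := count_delete hx hx'; rewrite es cntk //; lia.
have sA z : lab z = s :> nat -> z \in A.
  move=> ez; apply: hA; rewrite ez //.
    by move=> j0; apply/eqP=> /nj; exact.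
  by move=> kn; apply/eqP=> /nk; exact.
have rs : repeats v s s'.
  have [/andP[j0 /eqP es']|nj'] := boolP ((0 < j) && (s' == j :> nat)).
    have [x hx hx'] := hj j0.
    rewrite es' in ras *; apply: (rep_delete _ _ hx' sA ras); last by apply/eqP=> /esym/nj; exact.
    have -> : (s : nat) = j.+1 by move: ab; rewrite /nbr; lia.
    exact: hx.
  have [/andP[kn /eqP es']|nk'] := boolP ((k < n) && (s' == k :> nat)).
    have [x hx hx'] := hk kn.
    rewrite es' in ras *; apply: (rep_delete _ _ hx' sA ras); last by apply/eqP=> /esym/nk; exact.
    have -> : (s : nat) = k.-1 by move: ab; rewrite /nbr; lia.
    exact: hx.
  have s'A z : lab z = s' :> nat -> z \in A.
    by move=> ez; apply: hA; rewrite ez // => h; [move: nj' | move: nk']; rewrite h.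
  move: ras; rewrite /repeats /readA /v /read !filter_map -filter_predI.
  congr infix; congr map; apply: eq_filter => z /=.
  by case: eqP => [/sA -> //|_] /=; case: eqP => // /s'A ->.
have [es'|es'] : s' = s.+1 :> nat \/ s = s'.+1 :> nat by move: ab; rewrite /nbr; lia.
  rewrite es' in rs; have := up s ltac:(lia) rs.
  case: (eqVneq (s : nat) j) => [/nj|]; lia.
rewrite es' in rs; have := down s'.+1 ltac:(lia) rs.
case: (eqVneq (s : nat) k) => [/nk|]; lia.
Qed.

(** The deleted elements are the first ones of the repeated pairs at [j] and
    [k]. *)
Lemma peaked_families j k : peaked n v j k -> (0 < j -> repeats v j j.+1) ->
  (k < n -> repeats v k k.-1) -> ALT lab \/ LP lab \/ RP lab \/ LRP lab.
Proof.
move=> F repj repk; have [hjk up down left right] := F.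
have alt := peaked_alternating F.
have vn : all (leq^~ n) v by rewrite /v readE; exact: vals_le.
have cntj : 0 < j -> count_mem j v = 2.
  by move=> j0; rewrite (count_left_peak _ (left j0)) // count_lpeak // j0 leqnn.
have cntk : k < n -> count_mem k v = 2.
  by move=> kn; rewrite (count_right_peak vn _ (right kn)) ?count_lpeak //; lia.
have ej : nat_of_ord (@inord n j) = j by rewrite inordK; lia.
have ek : nat_of_ord (@inord n k) = k by rewrite inordK; lia.
have labE z (i : 'I_n.+1) : lab z = i :> nat -> lab z = i by move/val_inj.
have hL2 : 0 < j -> 0 < @inord n j < n /\ LP1 lab (inord j) /\ LP2 lab (inord j).
  move=> j0; split; first by rewrite ej; lia.
  split; first by apply/LP1P; rewrite ej // left.
  have [x0 hx0] := rep_splits (repj j0).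
  move=> x y z /(congr1 val) /= hx /(congr1 val) /= hy hz.
  by apply: (splits_not_between hx0 (cntj j0)); rewrite ?hx ?hy ?hz ej.
have hR2 : k < n -> 0 < @inord n k < n /\ RP1 lab (inord k) /\ RP2 lab (inord k).
  move=> kn; split; first by rewrite ek; lia.
  split; first by apply/RP1P; rewrite ek // right.
  have [x0 hx0] := rep_splits (repk kn).
  move=> x y z /(congr1 val) /= hx /(congr1 val) /= hy hz.
  by apply: (splits_not_between hx0 (cntk kn)); rewrite ?hx ?hy ?ek //; lia.
have lastn z : lab z <= n by rewrite -ltnS.
have [j0|j0] := posnP j; have [nk|kn] := leqP n k.
- left; rewrite /ALT (_ : [set: 'I_n.+1] = labels_from_to n j k); last first.
    by apply/setP=> s; rewrite !inE j0 /= (leq_trans _ nk) // -ltnS.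
  by apply: alt => [z _ _ _||]; [rewrite inE | lia | lia].
- right; right; left; have [h0 [h1 h2]] := hR2 kn.
  have [y hy] := rep_splits (repk kn); have [L1 [L2 [x' [L3 [_ ey _ _ _]]]]] := hy.
  exists (inord k); split=> //; exists y; first by apply: labE; rewrite ek.
  rewrite ek -j0; apply: alt; last 2 first.
  + lia.
  + move=> _; exists y => // z ez; rewrite !inE ez.
    have -> : j <= k <= k by lia.
    by rewrite andbT.
  + move=> z hz _ /(_ kn) zk; rewrite !inE hz andbT.
    by apply: contraNneq zk => ->; rewrite ey.
- right; left; have [h0 [h1 h2]] := hL2 j0.
  have [y hy] := rep_splits (repj j0); have [L1 [L2 [x' [L3 [_ ey _ _ _]]]]] := hy.
  exists (inord j); split=> //; exists y; first by apply: labE; rewrite ej.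
  have en : n = k by lia.
  rewrite ej [X in labels_from_to _ _ X]en; apply: alt.
  + move=> z hz /(_ j0) zk _; rewrite !inE hz andbT.
    by apply: contraNneq zk => ->; rewrite ey.
  + move=> _; exists y => // z ez; rewrite !inE ez.
    have -> : j <= j <= k by lia.
    by rewrite andbT.
  + lia.
right; right; right; have [h0 [h1 h2]] := hL2 j0; have [g0 [g1 g2]] := hR2 kn.
have [x hx] := rep_splits (repj j0); have [L1 [L2 [x' [L3 [_ ex _ _ _]]]]] := hx.
have [y hy] := rep_splits (repk kn); have [M1 [M2 [y' [M3 [_ ey _ _ _]]]]] := hy.
exists (inord j), (inord k); split=> //; first by split; lia.
exists x, y; split; [by apply: labE; rewrite ej | by apply: labE; rewrite ek |].
rewrite ej ek; apply: alt.
- move=> z hz /(_ j0) zj /(_ kn) zk; rewrite !inE hz andbT; apply/andP; split.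
    by apply: contraNneq zk => ->; rewrite ey.
  by apply: contraNneq zj => ->; rewrite ex.
- move=> _; exists x => // z ez; rewrite !inE ez.
  have -> : z != y by apply: contraTneq hjk => e; move: ez; rewrite e ey; lia.
  have -> : j <= j <= k by lia.
  by rewrite andbT.
- move=> _; exists y => // z ez; rewrite !inE ez.
  have -> : z != x by apply: contraTneq hjk => e; move: ez; rewrite e ex; lia.
  have -> : j <= k <= k by lia.
  by rewrite !andbT.
Qed.

Lemma vals_zigzag_period : vals (zigzag_period n) = zigrun n 0 n.*2.
Proof.
rewrite vals_word; last first.
  rewrite /= all_cat /= all_rev leqnn /=.
  by apply/andP; split; apply/allP=> c; rewrite mem_iota; lia.
have -> : n.*2 = n.+1 + n.-1 by lia.
rewrite zigrun_cat -[0]/(0 * n.*2 + 0) zigrun_up //.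
have -> : 0 * n.*2 + 0 + n.+1 = 0 * n.*2 + n + 1 by lia.
rewrite zigrun_down //; last lia.
have -> : iota 0 n.+1 = 0 :: iota 1 n.-1 ++ [:: n].
  have -> : n.+1 = 1 + (n.-1 + 1) by lia.
  by rewrite !iotaD /= add1n prednK //; lia.
rewrite cat_cons -catA; congr (_ :: _ ++ _ :: _).
apply: (@eq_from_nth _ 0); rewrite ?size_rev ?size_map !size_iota // => i hi.
by rewrite nth_rev ?size_iota // (nth_map 0) ?size_iota // !nth_iota //; lia.
Qed.

Lemma vals_zigzag_power k :
  vals (flatten (nseq k (zigzag_period n))) = zigrun n 0 (k * n.*2).
Proof.
elim: k => // k IH; set u := zigzag_period n in IH *.
have -> : flatten (nseq k.+1 u) = u ++ flatten (nseq k u) by [].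
rewrite map_cat IH vals_zigzag_period mulSn zigrun_cat add0n.
congr (_ ++ _); have := iotaDl n.*2 0 (k * n.*2).
rewrite addn0 /zigrun => ->; rewrite -map_comp.
by apply: eq_map => i; rewrite /= /zigzag modnDl.
Qed.

Lemma restrT : restr lab [set: 'I_n.+1] = [set: H].
Proof. by apply/setP=> x; rewrite !inE. Qed.

Lemma card_restr (i : 'I_n.+1) : #|restr lab [set i]| = count_mem (i : nat) v.
Proof.
rewrite /v /read count_map -size_filter.
rewrite -(card_uniqP (filter_uniq _ (linearization_uniq hL))).
by apply: eq_card => x; rewrite mem_filter hL.1 !inE andbT -(inj_eq val_inj).
Qed.

(** A zigzag is a chain, so that its heap has only one linear extension. *)
Lemma ZZP : ZZ lab <-> ZZword n v.
Proof.
have run_infix (w : seq 'I_n.+1) p : vals w = zigrun n p (size w) ->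
    iso_Heap (@graphC n) lab [set: H] w <-> map lab L = w.
  move=> ew; have := chain_isoP [set: 'I_n.+1] hL hH (chain_word ew).
  by rewrite restrT (eq_filter (a2 := predT)) ?filter_predT // => s; rewrite inE.
split=> [[[k [w [hw iso]]] [i [hi ci]]]|[[p ep] [i [hi ci]]]].
  move: hw; rewrite -infix_vals vals_zigzag_power => /infix_zigrun[p ew].
  rewrite size_map in ew; have e := iffLR (run_infix _ _ ew) iso.
  split; last by exists i; rewrite -card_restr.
  by exists p; rewrite /v readE e size_map.
have ew : vals (map lab L) = zigrun n p (size (map lab L)).
  by rewrite -readE -/v ep !size_map.
split; last first.
  have ei : nat_of_ord (@inord n i) = i by rewrite inordK; lia.
  by exists (inord i); rewrite card_restr ei.
(* Enough periods to reach beyond the last position of the word. *)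
set w := map lab L in ew *; exists (p + size w), w; split; last exact/(run_infix _ _ ew).
rewrite -infix_vals vals_zigzag_power ew.
have -> : (p + size w) * n.*2 = p + (size w + ((p + size w) * n.*2 - (p + size w))) by nia.
by rewrite 2!zigrun_cat add0n infix_infix.
Qed.

Lemma families_zigzag_or_peaked :
  ALT lab \/ ZZ lab \/ LP lab \/ RP lab \/ LRP lab -> zigzag_or_peaked n v.
Proof.
move=> h; have [/ZZP[hz _]|hf] : ZZ lab \/ ALT lab \/ LP lab \/ RP lab \/ LRP lab by tauto.
  by left.
by right; exact: families_peaked.
Qed.

Lemma convex_braid_free_families : convex_braid_free n v ->
  ALT lab \/ ZZ lab \/ LP lab \/ RP lab \/ LRP lab.
Proof.
move=> gv; have vn : all (leq^~ n) v by rewrite /v readE; exact: vals_le.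
case: (convex_braid_free_classification hn gv vn) => [/ZZP|[j [k [F rj rk]]]]; first by tauto.
by have := peaked_families F rj rk; tauto.
Qed.

End Transfer.

Theorem theorem3p4 (n : nat) (hn : 2 <= n) (d : Order.disp_t)
    (H : finPOrderType d) (lab : H -> 'I_n.+1)
    (hH : is_heap (@graphC n) lab) :
  FC_heap (@mC n) lab <->
  ALT lab \/ ZZ lab \/ LP lab \/ RP lab \/ LRP lab.
Proof.
split=> [[w [rw fw iso]]|hf].
  have [L hL ew] := iso_linearization iso.
  apply: (convex_braid_free_families hn hH hL); rewrite readE ew.
  by apply: braid_free_convex => //; apply/braid_free_FC_typeC.
have [L hL] := linearization_exists H.
have := families_zigzag_or_peaked hn hH hL hf; rewrite readE => /(zigzag_or_peaked_braid_free hn).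
case/(braid_free_FC_typeC hn) => rw fw; exists (map lab L); split=> //.
exact: linearization_iso hL hH.
Qed.
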